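(* Let $d>0$ be real, and for $u_0>0$ let $(u,V)$ be the solution of $$u''+\frac{d-1}{r}\,u'=(V-1)u,\qquad V''+\frac{d-1}{r}\,V'=u^2,\qquad u(0)=u_0,\ u'(0)=0,\ V(0)=0,\ V'(0)=0.$$ With the sets $\mathcal{G},\mathcal{N}\subset\,]0,\infty[$ of initial values defined in the context: if $d\ge 6$, then $1\in\mathcal{G}$; and if $d<6$, then $1\in\mathcal{N}$. In particular, for $d=6$ the ground state solution (the solution with initial value $u_0\in\mathcal{G}$, here $u_0=1$) is explicitly given by $$u(r)=\Big(1+\frac{r^2}{24}\Big)^{-2}.$$
   Context: For given $d>0$ the sets are $$\mathcal{N}=\{u_0>0:\ \exists\, r_0>0 \text{ such that } u(r_0)<0 \text{ and } u'(r)<0 \text{ on } ]0,r_0]\},$$ $$\mathcal{G}=\{u_0>0:\ (u,V)\text{ exists on }[0,\infty[,\ u\ge 0,\ \lim_{r\to\infty}u(r)=0\},$$ where $(u,V)$ is the solution (on its maximal interval of existence) of the stated initial value problem with $u(0)=u_0$. The parameter $d>0$ is real (not necessarily an integer). A solution on $[0,R[$ is a pair of real-valued functions $(u,V)$ that are $C^2$ on $[0,R[$, satisfy the differential equations on $]0,R[$ and the initial conditions at $r=0$; equivalently, $u$ and $V$ are continuous on $[0,R[$ with $u(0)=u_0$, $V(0)=0$, and for $r\in\,]0,R[$, $$u'(r)=r^{1-d}\int_0^r (V(s)-1)u(s)s^{d-1}\,ds,\qquad V'(r)=r^{1-d}\int_0^r u(s)^2s^{d-1}\,ds .$$ For each $u_0$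 the solution is unique. *)

(* Defs.v *)
From Stdlib Require Import Reals.
From Coquelicot Require Import Coquelicot.
Open Scope R_scope.

Definition interval (T : Rbar) (r : R) : Prop := 0 <= r /\ Rbar_lt (Finite r) T.

(* Derivatives and continuity are relative to I, hence one-sided at an endpoint
   belonging to I; values outside I are irrelevant. *)
Definition C2_on (I : R -> Prop) (f f1 f2 : R -> R) : Prop :=
  forall r, I r -> D_in f f1 I r /\ D_in f1 f2 I r /\ continue_in f2 I r.

Definition is_solution (d u0 : R) (T : Rbar) (u V : R -> R) : Prop :=
  Rbar_lt (Finite 0) T /\
  exists u1 u2 V1 V2 : R -> R,
    C2_on (interval T) u u1 u2 /\
    C2_on (interval T) V V1 V2 /\
    (forall r, 0 < r -> Rbar_lt (Finite r) T ->
       u2 r + (d - 1) / r * u1 r = (V r - 1) * u r /\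
       V2 r + (d - 1) / r * V1 r = u r ^ 2) /\
    u 0 = u0 /\ u1 0 = 0 /\ V 0 = 0 /\ V1 0 = 0.

Definition is_maximal_solution (d u0 : R) (T : Rbar) (u V : R -> R) : Prop :=
  is_solution d u0 T u V /\
  forall (T' : Rbar) (u' V' : R -> R),
    is_solution d u0 T' u' V' ->
    (forall r, interval T r -> u' r = u r /\ V' r = V r) ->
    Rbar_le T' T.

(* Derive u r is taken only at points r interior to the interval of existence. *)
Definition setN (d u0 : R) : Prop :=
  0 < u0 /\
  exists (T : Rbar) (u V : R -> R),
    is_maximal_solution d u0 T u V /\
    exists r0, 0 < r0 /\ Rbar_lt (Finite r0) T /\ u r0 < 0 /\
      forall r, 0 < r <= r0 -> Derive u r < 0.

Definition setG (d u0 : R) : Prop :=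
  0 < u0 /\
  exists u V : R -> R,
    is_maximal_solution d u0 p_infty u V /\
    (forall r, 0 <= r -> 0 <= u r) /\
    is_lim u p_infty 0.

(* Main.v *)
Require Import Defs.
From Stdlib Require Import Reals Lra Lia Classical ClassicalEpsilon.
From Coquelicot Require Import Coquelicot.
Open Scope R_scope.

(** For [u0 = 1] the functions [u] and [1 - V] solve the same problem, so they coincide
    with the solution [f] of the Lane-Emden equation [f'' + (d-1)/r f' = - f^2],
    [f 0 = 1], whose exponent 2 is critical exactly for [d = 6].  The Pohozaev function
      [P = r^d (f'^2 / 2 + f^3 / 3) + (d-2)/2 r^(d-1) f f']
    has [P' = (6-d)/6 r^(d-1) f^3] as long as [f >= 0].  If [d >= 6], then [P <= 0], which
    is impossible at a zero of [f].  If [d < 6] and [f] stayed nonnegative, then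
    [f = O(r^-2)] and [f' = O(r^-3)] would give [P = O(r^(d-6))], whereas [P] increases
    from 0.

    For the uniqueness of the ground state when [d = 6], put [z = u + V - 1]; then
    [z'' + (d-1)/r z' = u z], so [z^2] is nondecreasing.  If [u0 < 1], then [1 - V] is
    bounded below by a positive constant and [u] has to oscillate.  If [u0 > 1], then
    [V - 1] is eventually bounded below by a positive constant, [u] decays fast, and this
    contradicts the Pohozaev identity of the system, which for [d = 6] is a conservation
    law. *)

(** The square is only locally Lipschitz, whereas [setG] asks for a solution on the whole half-line
    and [setN] for a maximal one. The equation for [f] is therefore solved with [f] truncated to
    [-1, 1] before squaring. The truncated problem is globally Lipschitz and has a global solution;
    since [f] decreases from 1, the truncation acts only below -1. For [d >= 6] it never acts. For
    [d < 6] it is inactive up to a point beyond the zero of [f], and the solution on that finite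
    interval is extended to a maximal one by gluing, which rests on uniqueness. As [d] is any
    positive real, the weight [r^(d-1)] may be unbounded at 0. Limits at 0 are therefore taken from
    the right, and monotonicity arguments start from such limits instead of values at 0. *)

Definition lim0 (f : R -> R) (l : R) : Prop := filterlim f (at_right 0) (locally l).

Lemma lim0_spec (f : R -> R) (l : R) :
  lim0 f l <->
  forall eps, 0 < eps -> exists delta, 0 < delta /\
    forall x, 0 < x < delta -> Rabs (f x - l) < eps.
Proof.
  unfold lim0; rewrite filterlim_locally; split.
  - intros H eps Heps. destruct (H (mkposreal eps Heps)) as [delta Hd].
    exists delta; split; [apply cond_pos|]. intros x Hx. apply (Hd x); [|lra].
    change (Rabs (x - 0) < delta). rewrite Rminus_0_r, Rabs_pos_eq; lra.
  - intros H eps. destruct (H eps (cond_pos eps)) as [delta [Hd Hx]].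
    exists (mkposreal delta Hd). intros x Hb Hpos. apply (Hx x). split; [exact Hpos|].
    change (Rabs (x - 0) < delta) in Hb. rewrite Rminus_0_r, Rabs_pos_eq in Hb; lra.
Qed.

Lemma exp_le_compat (x y : R) : x <= y -> exp x <= exp y.
Proof. intros [H| ->]; [left; apply exp_increasing, H|right; reflexivity]. Qed.

Lemma lim0_const (c : R) : lim0 (fun _ => c) c.
Proof. apply filterlim_const. Qed.

Lemma lim0_plus (f g : R -> R) (a b : R) :
  lim0 f a -> lim0 g b -> lim0 (fun x => f x + g x) (a + b).
Proof.
  intros Hf Hg. eapply filterlim_comp_2; [exact Hf|exact Hg|apply (filterlim_plus a b)].
Qed.

Lemma lim0_mult (f g : R -> R) (a b : R) :
  lim0 f a -> lim0 g b -> lim0 (fun x => f x * g x) (a * b).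
Proof.
  intros Hf Hg. eapply filterlim_comp_2; [exact Hf|exact Hg|apply (filterlim_mult a b)].
Qed.

Lemma lim0_scal (c : R) (f : R -> R) (a : R) :
  lim0 f a -> lim0 (fun x => c * f x) (c * a).
Proof. intros Hf. exact (lim0_mult _ _ _ _ (lim0_const c) Hf). Qed.

Lemma lim0_minus (f g : R -> R) (a b : R) :
  lim0 f a -> lim0 g b -> lim0 (fun x => f x - g x) (a - b).
Proof.
  intros Hf Hg. apply lim0_spec; intros eps He.
  pose proof (lim0_plus _ _ _ _ Hf (lim0_scal (-1) _ _ Hg)) as H.
  destruct (proj1 (lim0_spec _ _) H eps He) as [delta [Hd Hx]].
  exists delta; split; [exact Hd|]. intros x Hb. specialize (Hx x Hb). cbv beta in Hx.
  replace (f x - g x - (a - b)) with (f x + -1 * g x - (a + -1 * b)) by ring. exact Hx.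
Qed.

Lemma lim0_eq (f g : R -> R) (a b : R) :
  (forall x, 0 < x -> f x = g x) -> a = b -> lim0 f a -> lim0 g b.
Proof.
  intros Hfg <- H. apply lim0_spec; intros eps He.
  destruct (proj1 (lim0_spec _ _) H eps He) as [delta [Hd Hx]].
  exists delta; split; [exact Hd|]. intros x Hb. rewrite <- Hfg by lra. auto.
Qed.

Lemma lim0_continuous (f : R -> R) : continuous f 0 -> lim0 f (f 0).
Proof.
  intros H P HP. destruct (H P HP) as [delta Hd]. exists delta. intros y Hy _. exact (Hd y Hy).
Qed.

Lemma lim0_id : lim0 (fun x => x) 0.
Proof. apply (lim0_continuous (fun x => x)), continuous_id. Qed.

Lemma Rpower_lim0 (e : R) : 0 < e -> lim0 (fun x => Rpower x e) 0.
Proof.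
  intros He. apply lim0_spec; intros eps Heps.
  exists (Rpower eps (/ e)); split; [apply exp_pos|].
  intros x [Hx0 Hx]. rewrite Rminus_0_r, Rabs_pos_eq by (left; apply exp_pos).
  apply Rlt_le_trans with (Rpower (Rpower eps (/ e)) e).
  - apply Rlt_Rpower_l; lra.
  - rewrite Rpower_mult, Rinv_l, Rpower_1; lra.
Qed.

Lemma Rpower_split (r d : R) : 0 < r -> Rpower r d = r * Rpower r (d - 1).
Proof.
  intros Hr. rewrite <- (Rpower_1 r) at 2 by assumption. rewrite <- Rpower_plus. f_equal; ring.
Qed.

Lemma is_derive_Rpower (r e : R) :
  0 < r -> is_derive (fun x => Rpower x e) r (e / r * Rpower r e).
Proof.
  intros Hr. unfold Rpower. auto_derive; [lra|]. field; lra.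
Qed.

Lemma antitone (F F' : R -> R) (a b : R) :
  a <= b -> (forall x, a <= x <= b -> is_derive F x (F' x)) ->
  (forall x, a < x < b -> F' x <= 0) -> F b <= F a.
Proof.
  intros [Hab| ->] HF HF'; [|lra].
  destruct (MVT_cor2 F F' a b Hab) as [c [Hc Hc']].
  - intros c Hc. apply is_derive_Reals, HF, Hc.
  - specialize (HF' c Hc'). nra.
Qed.

(** Monotonicity up to the singular endpoint: [F] is compared with its right limit, so nothing is
    asked of [F] at 0 itself. If [F r] exceeded [l], some point near 0 would have a value below
    [F r], against [antitone]. *)
Lemma antitone_lim0 (F F' : R -> R) (r l : R) :
  0 < r -> (forall x, 0 < x <= r -> is_derive F x (F' x)) ->
  (forall x, 0 < x < r -> F' x <= 0) -> lim0 F l -> F r <= l.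
Proof.
  intros Hr HF HF' Hl. apply Rnot_lt_le; intros Hlt.
  destruct (proj1 (lim0_spec _ _) Hl (F r - l)) as [delta [Hd Hx]]; [lra|].
  pose (x := Rmin delta r / 2).
  assert (Hm : 0 < Rmin delta r) by (apply Rmin_glb_lt; assumption).
  pose proof (Rmin_l delta r). pose proof (Rmin_r delta r).
  specialize (Hx x ltac:(unfold x; lra)). apply Rabs_def2 in Hx.
  assert (F r <= F x); [|lra].
  apply (antitone F F').
  - unfold x; lra.
  - intros y Hy; apply HF; unfold x in Hy; lra.
  - intros y Hy; apply HF'; unfold x in Hy; lra.
Qed.

(** * Radial equations *)

(* [f'' + (d-1)/r f' = h] on (0, T).  The last condition excludes singular solutions; for
   [d < 1] it does not follow from [f1 -> 0]. *)
Record radial (d : R) (T : Rbar) (f f1 h : R -> R) : Prop := {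
  rad_d : forall r, 0 < r -> Rbar_lt (Finite r) T -> is_derive f r (f1 r);
  rad_d1 : forall r, 0 < r -> Rbar_lt (Finite r) T ->
    is_derive f1 r (h r - (d - 1) / r * f1 r);
  rad_l : lim0 f (f 0);
  rad_l1 : lim0 f1 0;
  rad_lflux : lim0 (fun r => Rpower r (d - 1) * f1 r) 0 }.

Arguments rad_d {d T f f1 h}.
Arguments rad_d1 {d T f f1 h}.
Arguments rad_l {d T f f1 h}.
Arguments rad_l1 {d T f f1 h}.
Arguments rad_lflux {d T f f1 h}.

Lemma Rbar_le_lt (x y : R) (T : Rbar) : x <= y -> Rbar_lt (Finite y) T -> Rbar_lt (Finite x) T.
Proof. intros H. apply Rbar_le_lt_trans. exact H. Qed.

Lemma radial_comb (d a b : R) (T : Rbar) (f f1 h g g1 k : R -> R) :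
  radial d T f f1 h -> radial d T g g1 k ->
  radial d T (fun r => a * f r + b * g r) (fun r => a * f1 r + b * g1 r)
    (fun r => a * h r + b * k r).
Proof.
  intros [F1 F2 F3 F4 F5] [G1 G2 G3 G4 G5]; split.
  - intros r Hr HT. exact (is_derive_plus _ _ _ _ _ (is_derive_scal _ _ a _ (F1 r Hr HT))
      (is_derive_scal _ _ b _ (G1 r Hr HT))).
  - intros r Hr HT.
    replace (a * h r + b * k r - (d - 1) / r * (a * f1 r + b * g1 r))
      with (a * (h r - (d - 1) / r * f1 r) + b * (k r - (d - 1) / r * g1 r)) by ring.
    exact (is_derive_plus _ _ _ _ _ (is_derive_scal _ _ a _ (F2 r Hr HT))
      (is_derive_scal _ _ b _ (G2 r Hr HT))).
  - exact (lim0_plus _ _ _ _ (lim0_scal a _ _ F3) (lim0_scal b _ _ G3)).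
  - eapply lim0_eq; [intros; reflexivity| |
      exact (lim0_plus _ _ _ _ (lim0_scal a _ _ F4) (lim0_scal b _ _ G4))]. ring.
  - eapply lim0_eq; [| |exact (lim0_plus _ _ _ _ (lim0_scal a _ _ F5) (lim0_scal b _ _ G5))].
    + intros; cbv beta; ring.
    + ring.
Qed.

Lemma radial_const (d c : R) (T : Rbar) : radial d T (fun _ => c) (fun _ => 0) (fun _ => 0).
Proof.
  split.
  - intros; apply @is_derive_const.
  - intros r _ _. replace (0 - (d - 1) / r * 0) with 0 by ring. apply @is_derive_const.
  - apply lim0_const.
  - apply lim0_const.
  - eapply lim0_eq; [| |apply (lim0_const 0)]; [intros; cbv beta; ring|reflexivity].
Qed.

(** Divergence form: the logarithmic derivative [(d - 1) / r] of the weight cancels the first order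
    term. *)
Lemma flux_derive (d : R) (T : Rbar) (f f1 h : R -> R) (r : R) :
  radial d T f f1 h -> 0 < r -> Rbar_lt (Finite r) T ->
  is_derive (fun x => Rpower x (d - 1) * f1 x) r (Rpower r (d - 1) * h r).
Proof.
  intros H Hr HT.
  evar_last.
  - apply (is_derive_mult (fun x => Rpower x (d - 1)) f1 r).
    + apply is_derive_Rpower, Hr.
    + apply (rad_d1 H r Hr HT).
    + intros; apply Rmult_comm.
  - unfold plus, mult; simpl. field. lra.
Qed.

Lemma flux_antitone (d : R) (T : Rbar) (f f1 h : R -> R) (a b : R) :
  radial d T f f1 h -> 0 < a <= b -> Rbar_lt (Finite b) T ->
  (forall r, a < r < b -> h r <= 0) ->
  Rpower b (d - 1) * f1 b <= Rpower a (d - 1) * f1 a.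
Proof.
  intros H Hab HT Hh.
  apply (antitone (fun x => Rpower x (d - 1) * f1 x) (fun x => Rpower x (d - 1) * h x)); [lra| |].
  - intros x Hx; apply (flux_derive d T f f1 h x H); [lra|]. apply Rbar_le_lt with b; [lra|exact HT].
  - intros x Hx. assert (0 < Rpower x (d - 1)) by apply exp_pos. specialize (Hh x Hx). nra.
Qed.

(** Comparison with the constant right-hand side [M], whose flux is [M / d * r^d]: the difference of
    the fluxes is nonincreasing and starts from the limit 0, which is where [rad_lflux] enters. *)
Lemma derivative_le (d M : R) (T : Rbar) (f f1 h : R -> R) (r : R) :
  0 < d -> radial d T f f1 h -> 0 < r -> Rbar_lt (Finite r) T ->
  (forall s, 0 < s < r -> h s <= M) -> f1 r <= M / d * r.
Proof.
  intros Hd H Hr HT Hh.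
  assert (Hp : 0 < Rpower r (d - 1)) by apply exp_pos.
  assert (Rpower r (d - 1) * f1 r - M / d * Rpower r d <= 0).
  { apply (antitone_lim0 (fun x => Rpower x (d - 1) * f1 x - M / d * Rpower x d)
      (fun x => Rpower x (d - 1) * h x - M / d * (d / x * Rpower x d)) r 0 Hr).
    - intros x Hx. apply @is_derive_minus.
      + apply (flux_derive d T f f1 h x H); [lra|]. apply Rbar_le_lt with r; [lra|exact HT].
      + apply is_derive_scal, is_derive_Rpower; lra.
    - intros x Hx. rewrite (Rpower_split x d) by lra.
      replace (M / d * (d / x * (x * Rpower x (d - 1)))) with (M * Rpower x (d - 1)) by (field; lra).
      assert (0 < Rpower x (d - 1)) by apply exp_pos. specialize (Hh x Hx). nra.
    - eapply lim0_eq; [intros; reflexivity| |exact (lim0_minus _ _ _ _ (rad_lflux H)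
        (lim0_scal (M / d) _ _ (Rpower_lim0 d Hd)))]. ring. }
  rewrite (Rpower_split r d Hr) in H0.
  apply Rmult_le_reg_l with (Rpower r (d - 1)); [exact Hp|]. lra.
Qed.

(** Estimates are proved from above only; applied to [- f] they give the bounds from below. *)
Lemma radial_opp (d : R) (T : Rbar) (f f1 h : R -> R) :
  radial d T f f1 h ->
  radial d T (fun r => - f r) (fun r => - f1 r) (fun r => - h r).
Proof.
  intros [F1 F2 F3 F4 F5]; split.
  - intros r Hr HT. exact (is_derive_opp _ _ _ (F1 r Hr HT)).
  - intros r Hr HT. evar_last; [exact (is_derive_opp _ _ _ (F2 r Hr HT))|].
    unfold opp; simpl; ring.
  - eapply lim0_eq; [| |exact (lim0_scal (-1) _ _ F3)]; intros; cbv beta; ring.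
  - eapply lim0_eq; [| |exact (lim0_scal (-1) _ _ F4)]; intros; cbv beta; ring.
  - eapply lim0_eq; [| |exact (lim0_scal (-1) _ _ F5)]; intros; cbv beta; ring.
Qed.

Lemma radial_le (d : R) (T : Rbar) (f f1 h G G1 : R -> R) (r : R) :
  radial d T f f1 h -> 0 < r -> Rbar_lt (Finite r) T ->
  (forall x, is_derive G x (G1 x)) ->
  (forall s, 0 < s < r -> f1 s <= G1 s) -> f r - f 0 <= G r - G 0.
Proof.
  intros H Hr HT HG Hle.
  assert (f r - G r <= f 0 - G 0); [|lra].
  apply (antitone_lim0 (fun x => f x - G x) (fun x => f1 x - G1 x) r); auto.
  - intros x Hx. apply @is_derive_minus; [|apply HG].
    apply (rad_d H); [lra|]. apply Rbar_le_lt with r; [lra|exact HT].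
  - intros x Hx; specialize (Hle x Hx); lra.
  - apply lim0_minus; [apply (rad_l H)|]. apply lim0_continuous.
    apply @ex_derive_continuous. exists (G1 0). apply HG.
Qed.

Lemma value_le (d M : R) (T : Rbar) (f f1 h : R -> R) (r : R) :
  0 < d -> radial d T f f1 h -> 0 < r -> Rbar_lt (Finite r) T ->
  (forall s, 0 < s < r -> h s <= M) -> f r <= f 0 + M / d * r ^ 2 / 2.
Proof.
  intros Hd H Hr HT Hh.
  enough (f r - f 0 <= M / d * r ^ 2 / 2 - M / d * 0 ^ 2 / 2) by lra.
  apply (radial_le d T f f1 h (fun x => M / d * x ^ 2 / 2) (fun x => M / d * x) r H Hr HT).
  - intros x. auto_derive; [trivial|field; lra].
  - intros s Hs. apply (derivative_le d M T f f1 h s Hd H); [lra| |].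
    + apply Rbar_le_lt with r; [lra|exact HT].
    + intros t Ht; apply Hh; lra.
Qed.

(* The weight [exp (l r^2)] makes the solution operator a contraction on all of
   [0, oo) at once: its norm is at most [1 / (2 d l)]. *)
Lemma weighted_le (d M l : R) (T : Rbar) (f f1 h : R -> R) (r : R) :
  0 < d -> 0 < l -> 0 <= M -> radial d T f f1 h -> 0 < r -> Rbar_lt (Finite r) T ->
  (forall s, 0 < s < r -> h s <= M * exp (l * s ^ 2)) ->
  f r - f 0 <= M / (2 * d * l) * exp (l * r ^ 2).
Proof.
  intros Hd Hl HM H Hr HT Hh.
  apply Rle_trans with (M / (2 * d * l) * exp (l * r ^ 2) - M / (2 * d * l) * exp (l * 0 ^ 2)).
  - apply (radial_le d T f f1 h (fun x => M / (2 * d * l) * exp (l * x ^ 2))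
      (fun x => M * exp (l * x ^ 2) / d * x) r H Hr HT).
    + intros x. auto_derive; [trivial|]. simpl. field; lra.
    + intros s Hs. apply (derivative_le d _ T f f1 h s Hd H); [lra| |].
      * apply Rbar_le_lt with r; [lra|exact HT].
      * intros t Ht. apply Rle_trans with (M * exp (l * t ^ 2)); [apply Hh; lra|].
        apply Rmult_le_compat_l; [exact HM|].
        apply exp_le_compat. apply Rmult_le_compat_l; [lra|nra].
  - assert (0 <= M / (2 * d * l)) by (apply Rcomplements.Rdiv_le_0_compat; nra).
    assert (0 < exp (l * 0 ^ 2)) by apply exp_pos. nra.
Qed.

(** * Solutions as pairs of radial functions *)

Lemma Rbar_lt_near (r : R) (T : Rbar) :
  Rbar_lt (Finite r) T ->
  exists delta, 0 < delta /\ forall x, Rabs (x - r) < delta -> Rbar_lt (Finite x) T.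
Proof.
  destruct T as [t| |]; simpl; intros H.
  - exists (t - r); split; [lra|]. intros x Hx. apply Rabs_def2 in Hx. lra.
  - exists 1; split; [lra|]. auto.
  - contradiction.
Qed.

Lemma is_derive_D_in (f f1 : R -> R) (I : R -> Prop) (r : R) :
  is_derive f r (f1 r) -> D_in f f1 I r.
Proof.
  intros H eps Heps. apply is_derive_Reals in H.
  destruct (H eps Heps) as [delta Hd]. exists delta. split; [apply cond_pos|].
  simpl. unfold Rdist. intros x [[_ Hne] Hx].
  specialize (Hd (x - r) ltac:(lra) Hx). replace (r + (x - r)) with x in Hd by ring. exact Hd.
Qed.

Lemma continuous_continue_in (f : R -> R) (I : R -> Prop) (r : R) :
  continuous f r -> continue_in f I r.
Proof.
  intros H eps Heps. destruct (proj1 (filterlim_locally _ _) H (mkposreal eps Heps)) as [delta Hd].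
  exists delta. split; [apply cond_pos|]. intros x [_ Hx]. exact (Hd x Hx).
Qed.

Lemma D_in_is_derive (f f1 : R -> R) (T : Rbar) (r : R) :
  0 < r -> Rbar_lt (Finite r) T -> D_in f f1 (interval T) r -> is_derive f r (f1 r).
Proof.
  intros Hr HT H. apply is_derive_Reals. intros eps Heps.
  destruct (H eps Heps) as [a [Ha Hlim]]. destruct (Rbar_lt_near r T HT) as [b [Hb Hnear]].
  assert (Hm : 0 < Rmin r (Rmin a b)) by (repeat apply Rmin_glb_lt; assumption).
  exists (mkposreal _ Hm). simpl. intros x Hx0 Hx.
  pose proof (Rmin_l r (Rmin a b)). pose proof (Rmin_r r (Rmin a b)).
  pose proof (Rmin_l a b). pose proof (Rmin_r a b).
  specialize (Hlim (r + x)). simpl in Hlim. unfold Rdist in Hlim.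
  replace (r + x - r) with x in Hlim by ring. apply Hlim. split; [|lra].
  split; [|lra]. split.
  - apply Rabs_def2 in Hx; lra.
  - apply Hnear. replace (r + x - r) with x by ring. lra.
Qed.

Lemma continue_in_lim0 (f : R -> R) (T : Rbar) :
  Rbar_lt (Finite 0) T -> continue_in f (interval T) 0 -> lim0 f (f 0).
Proof.
  intros HT H. apply lim0_spec. intros eps Heps.
  destruct (H eps Heps) as [a [Ha Hlim]]. destruct (Rbar_lt_near 0 T HT) as [b [Hb Hnear]].
  exists (Rmin a b). split; [apply Rmin_glb_lt; assumption|]. intros x Hx.
  pose proof (Rmin_l a b). pose proof (Rmin_r a b).
  assert (E : Rabs (x - 0) = x) by (rewrite Rminus_0_r; apply Rabs_pos_eq; lra).
  apply (Hlim x). simpl. unfold Rdist. rewrite E. split; [|lra]. split; [|lra].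
  split; [lra|]. apply Hnear. lra.
Qed.

Lemma D_in_lim0 (f f1 : R -> R) (T : Rbar) :
  Rbar_lt (Finite 0) T -> D_in f f1 (interval T) 0 -> lim0 (fun x => (f x - f 0) / x) (f1 0).
Proof.
  intros HT H. apply lim0_spec. intros eps Heps.
  destruct (H eps Heps) as [a [Ha Hlim]]. destruct (Rbar_lt_near 0 T HT) as [b [Hb Hnear]].
  exists (Rmin a b). split; [apply Rmin_glb_lt; assumption|]. intros x Hx.
  pose proof (Rmin_l a b). pose proof (Rmin_r a b).
  assert (E : Rabs (x - 0) = x) by (rewrite Rminus_0_r; apply Rabs_pos_eq; lra).
  specialize (Hlim x). simpl in Hlim. unfold Rdist in Hlim. rewrite E, Rminus_0_r in Hlim.
  apply Hlim. split; [|lra]. split; [|lra]. split; [lra|]. apply Hnear. lra.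
Qed.

(** The flux condition holds for every positive [d] because [r^(d-1) f1 = r^d (f1 / r)]: here [r^d]
    tends to 0, and [f1 / r] tends to [f2 0] by differentiability of [f1] at 0. *)
Lemma C2_on_radial (d : R) (T : Rbar) (f f1 f2 h : R -> R) :
  0 < d -> Rbar_lt (Finite 0) T -> C2_on (interval T) f f1 f2 -> f1 0 = 0 ->
  (forall r, 0 < r -> Rbar_lt (Finite r) T -> f2 r + (d - 1) / r * f1 r = h r) ->
  radial d T f f1 h.
Proof.
  intros Hd HT HC H0 Heq.
  assert (Hin : forall r, 0 < r -> Rbar_lt (Finite r) T -> interval T r)
    by (intros r Hr HrT; split; [lra|exact HrT]).
  destruct (HC 0 (conj (Rle_refl 0) HT)) as [D1 [D2 _]].
  split.
  - intros r Hr HrT. apply D_in_is_derive with T; auto. apply (HC r (Hin r Hr HrT)).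
  - intros r Hr HrT. replace (h r - (d - 1) / r * f1 r) with (f2 r)
      by (rewrite <- Heq by assumption; ring).
    apply D_in_is_derive with T; auto. apply (HC r (Hin r Hr HrT)).
  - apply continue_in_lim0 with T; [exact HT|]. exact (cont_deriv _ _ _ _ D1).
  - rewrite <- H0. apply continue_in_lim0 with T; [exact HT|]. exact (cont_deriv _ _ _ _ D2).
  - eapply lim0_eq; [| |exact (lim0_mult _ _ _ _ (Rpower_lim0 d Hd) (D_in_lim0 _ _ _ HT D2))].
    + intros x Hx; cbv beta. rewrite (Rpower_split x d Hx), H0. field. lra.
    + ring.
Qed.

(** [is_solution] with the derivatives exposed and [u 0] left free, so that uniqueness and gluing
    can treat the derivatives too. *)
Definition solves (d : R) (T : Rbar) (u u1 u2 V V1 V2 : R -> R) : Prop :=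
  C2_on (interval T) u u1 u2 /\
  C2_on (interval T) V V1 V2 /\
  (forall r, 0 < r -> Rbar_lt (Finite r) T ->
     u2 r + (d - 1) / r * u1 r = (V r - 1) * u r /\
     V2 r + (d - 1) / r * V1 r = u r ^ 2) /\
  u1 0 = 0 /\ V 0 = 0 /\ V1 0 = 0.

Lemma is_solution_solves (d u0 : R) (T : Rbar) (u V : R -> R) :
  is_solution d u0 T u V ->
  Rbar_lt (Finite 0) T /\ u 0 = u0 /\ exists u1 u2 V1 V2, solves d T u u1 u2 V V1 V2.
Proof.
  intros [HT [u1 [u2 [V1 [V2 [H1 [H2 [H3 [H4 [H5 [H6 H7]]]]]]]]]]]. split; [exact HT|split; [exact H4|]].
  exists u1, u2, V1, V2. exact (conj H1 (conj H2 (conj H3 (conj H5 (conj H6 H7))))).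
Qed.

Lemma solves_radial (d : R) (T : Rbar) (u u1 u2 V V1 V2 : R -> R) :
  0 < d -> Rbar_lt (Finite 0) T -> solves d T u u1 u2 V V1 V2 ->
  radial d T u u1 (fun r => (V r - 1) * u r) /\ radial d T V V1 (fun r => u r ^ 2).
Proof.
  intros Hd HT [H1 [H2 [H3 [H4 [H5 H6]]]]]. split.
  - apply C2_on_radial with u2; auto. intros r Hr HrT; apply H3; auto.
  - apply C2_on_radial with V2; auto. intros r Hr HrT; apply H3; auto.
Qed.

Lemma C2_on_restrict (T T' : Rbar) (f f1 f2 : R -> R) :
  Rbar_le T' T -> C2_on (interval T) f f1 f2 -> C2_on (interval T') f f1 f2.
Proof.
  intros HT H r Hr.
  assert (Hsub : forall x, interval T' x -> interval T x)
    by (intros x [Hx1 Hx2]; split; [exact Hx1|exact (Rbar_lt_le_trans _ _ _ Hx2 HT)]).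
  destruct (H r (Hsub r Hr)) as [H1 [H2 H3]].
  split; [|split].
  - intros eps He. destruct (H1 eps He) as [a [Ha Hl]]. exists a; split; [exact Ha|].
    intros x [[Hx1 Hx2] Hx3]; apply Hl; repeat split; auto; apply Hsub, Hx1.
  - intros eps He. destruct (H2 eps He) as [a [Ha Hl]]. exists a; split; [exact Ha|].
    intros x [[Hx1 Hx2] Hx3]; apply Hl; repeat split; auto; apply Hsub, Hx1.
  - intros eps He. destruct (H3 eps He) as [a [Ha Hl]]. exists a; split; [exact Ha|].
    intros x [[Hx1 Hx2] Hx3]; apply Hl; repeat split; auto; apply Hsub, Hx1.
Qed.

Lemma solves_restrict (d : R) (T T' : Rbar) (u u1 u2 V V1 V2 : R -> R) :
  Rbar_le T' T -> solves d T u u1 u2 V V1 V2 -> solves d T' u u1 u2 V V1 V2.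
Proof.
  intros HT [H1 [H2 [H3 H4]]]. split; [|split; [|split; [|exact H4]]].
  - exact (C2_on_restrict _ _ _ _ _ HT H1).
  - exact (C2_on_restrict _ _ _ _ _ HT H2).
  - intros r Hr HrT. apply H3; [exact Hr|]. exact (Rbar_lt_le_trans _ _ _ HrT HT).
Qed.

(** Near 0 the limit bounds [f]; on the remaining compact interval [f] is continuous, because [R0]
    lies strictly below [T]. *)
Lemma radial_bounded (d R0 : R) (T : Rbar) (f f1 h : R -> R) :
  radial d T f f1 h -> Rbar_lt (Finite R0) T ->
  exists K, forall r, 0 < r <= R0 -> Rabs (f r) <= K.
Proof.
  intros H HT.
  destruct (proj1 (lim0_spec _ _) (rad_l H) 1 Rlt_0_1) as [delta [Hd Hnear]].
  destruct (Rle_or_lt R0 (delta / 2)) as [Hle|Hlt].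
  - exists (Rabs (f 0) + 1). intros r Hr. specialize (Hnear r ltac:(lra)).
    pose proof (Rabs_triang_inv (f r) (f 0)). lra.
  - destruct (continuity_ab_maj (fun x => Rabs (f x)) (delta / 2) R0) as [c [Hc _]]; [lra| |].
    + intros x Hx. apply continuity_pt_filterlim.
      apply (continuous_comp f Rabs); [|apply continuous_Rabs].
      apply @ex_derive_continuous. exists (f1 x). apply (rad_d H); [lra|].
      apply Rbar_le_lt with R0; [lra|exact HT].
    + exists (Rmax (Rabs (f 0) + 1) (Rabs (f c))). intros r Hr.
      destruct (Rle_or_lt r (delta / 2)) as [H1|H1].
      * eapply Rle_trans; [|apply Rmax_l]. specialize (Hnear r ltac:(lra)).
        pose proof (Rabs_triang_inv (f r) (f 0)). lra.
      * eapply Rle_trans; [|apply Rmax_r]. apply (Hc r). lra.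
Qed.

Lemma weighted_Rabs_le (d M l : R) (T : Rbar) (f f1 h : R -> R) (r : R) :
  0 < d -> 0 < l -> 0 <= M -> radial d T f f1 h -> f 0 = 0 -> 0 < r -> Rbar_lt (Finite r) T ->
  (forall s, 0 < s < r -> Rabs (h s) <= M * exp (l * s ^ 2)) ->
  Rabs (f r) <= M / (2 * d * l) * exp (l * r ^ 2).
Proof.
  intros Hd Hl HM H H0 Hr HT Hh. apply Rabs_le.
  pose proof (weighted_le d M l T f f1 h r Hd Hl HM H Hr HT) as H1.
  pose proof (weighted_le d M l T _ _ _ r Hd Hl HM (radial_opp _ _ _ _ _ H) Hr HT) as H2.
  cbv beta in H2. rewrite H0 in H1, H2. split.
  - assert (- f r - - 0 <= M / (2 * d * l) * exp (l * r ^ 2)); [|lra].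
    apply H2. intros s Hs. specialize (Hh s Hs).
    pose proof (Rle_abs (- h s)). rewrite Rabs_Ropp in *. lra.
  - assert (f r - 0 <= M / (2 * d * l) * exp (l * r ^ 2)); [|lra].
    apply H1. intros s Hs. specialize (Hh s Hs). pose proof (Rle_abs (h s)). lra.
Qed.

(** * Uniqueness for the initial value problem *)

Lemma pow_half_le_0 (x K : R) : (forall n, Rabs x <= K * (1 / 2) ^ n) -> x = 0.
Proof.
  intros H. apply NNPP; intros Hx. assert (Hpos : 0 < Rabs x) by (apply Rabs_pos_lt, Hx).
  assert (HK : 0 < K) by (specialize (H 0%nat); simpl in H; lra).
  destruct (pow_lt_1_zero (1 / 2) ltac:(rewrite Rabs_pos_eq; lra) (Rabs x / K)) as [N HN].
  - apply Rdiv_lt_0_compat; lra.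
  - specialize (HN N (le_n N)). rewrite Rabs_pos_eq in HN by (apply pow_le; lra).
    specialize (H N). apply Rmult_lt_compat_l with (r := K) in HN; [|exact HK].
    replace (K * (Rabs x / K)) with (Rabs x) in HN by (field; lra). lra.
Qed.

Lemma Rabs_bound_pos (f : R -> R) (b K : R) :
  (forall r, 0 < r <= b -> Rabs (f r) <= K) ->
  exists K', 0 <= K' /\ forall r, 0 < r <= b -> Rabs (f r) <= K'.
Proof.
  intros H. exists (Rabs K). split; [apply Rabs_pos|]. intros r Hr.
  apply Rle_trans with K; [auto|apply Rle_abs].
Qed.

(** The Picard estimate, run on the difference of two solutions: both are bounded on (0, R0], so the
    right-hand sides are Lipschitz there, and each use of the weighted estimate halves the bound. *)
Lemma radial_system_unique (d R0 : R) (T : Rbar) (u u1 V V1 u' u1' V' V1' : R -> R) :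
  0 < d -> Rbar_lt (Finite R0) T -> u 0 = u' 0 -> V 0 = V' 0 ->
  radial d T u u1 (fun r => (V r - 1) * u r) -> radial d T V V1 (fun r => u r ^ 2) ->
  radial d T u' u1' (fun r => (V' r - 1) * u' r) -> radial d T V' V1' (fun r => u' r ^ 2) ->
  forall r, 0 < r <= R0 -> u r = u' r /\ V r = V' r.
Proof.
  intros Hd HT E0 F0 Hu HV Hu' HV'.
  destruct (radial_bounded _ R0 _ _ _ _ Hu HT) as [Ku Bu].
  destruct (radial_bounded _ R0 _ _ _ _ HV HT) as [KV BV].
  destruct (radial_bounded _ R0 _ _ _ _ Hu' HT) as [Ku' Bu'].
  destruct (radial_bounded _ R0 _ _ _ _ HV' HT) as [KV' BV'].
  pose proof (radial_comb d 1 (-1) T _ _ _ _ _ _ Hu Hu') as Du.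
  pose proof (radial_comb d 1 (-1) T _ _ _ _ _ _ HV HV') as DV.
  cbv beta in Du, DV.
  destruct (Rabs_bound_pos _ _ _ Bu) as [K1 [HK1 C1]].
  destruct (Rabs_bound_pos _ _ _ Bu') as [K2 [HK2 C2]].
  destruct (Rabs_bound_pos _ _ _ BV) as [K3 [HK3 C3]].
  destruct (Rabs_bound_pos _ _ _ BV') as [K4 [HK4 C4]].
  (* [K] dominates the coefficients [V - 1], [u'] and [u + u'] of the difference equations; [N]
     dominates the differences themselves, to start the induction. *)
  pose (K := 1 + K1 + K2 + K3). pose (N := K + K4).
  assert (HK : 1 <= K) by (unfold K; lra).
  (* Then [2 * d * l = 4 * K], twice the Lipschitz constant [2 * K], so each step gains a factor
     1/2. *)
  pose (l := 2 * K / d).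
  assert (Hl : 0 < l) by (apply Rdiv_lt_0_compat; lra).
  assert (Main : forall n r, 0 < r <= R0 ->
    Rabs (1 * u r + -1 * u' r) <= N * (1 / 2) ^ n * exp (l * r ^ 2) /\
    Rabs (1 * V r + -1 * V' r) <= N * (1 / 2) ^ n * exp (l * r ^ 2)).
  { induction n as [|n IH]; intros r Hr.
    - specialize (C1 r Hr); specialize (C2 r Hr); specialize (C3 r Hr); specialize (C4 r Hr).
      assert (1 <= exp (l * r ^ 2)).
      { rewrite <- exp_0. apply exp_le_compat. apply Rmult_le_pos; [lra|apply pow2_ge_0]. }
      assert (N * 1 <= N * exp (l * r ^ 2)) by (apply Rmult_le_compat_l; [unfold N; lra|lra]).
      replace (N * (1 / 2) ^ 0 * exp (l * r ^ 2)) with (N * exp (l * r ^ 2)) by (simpl; ring).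
      unfold N, K in *. split;
        (apply Rabs_le; apply Rcomplements.Rabs_le_between in C1, C2, C3, C4; lra).
    - assert (HrT : Rbar_lt (Finite r) T) by (apply Rbar_le_lt with R0; [lra|exact HT]).
      assert (HM : 0 <= 2 * K * (N * (1 / 2) ^ n)).
      { apply Rmult_le_pos; [lra|]. apply Rmult_le_pos; [unfold N; lra|apply pow_le; lra]. }
      assert (E : N * (1 / 2) ^ S n = 2 * K * (N * (1 / 2) ^ n) / (2 * d * l))
        by (unfold l; simpl; field; lra).
      rewrite E. split.
      + apply (weighted_Rabs_le d _ l T _ _ _ r Hd Hl HM Du); [lra|lra|exact HrT|].
        intros s Hs. destruct (IH s ltac:(lra)) as [I1 I2].
        replace (1 * ((V s - 1) * u s) + -1 * ((V' s - 1) * u' s))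
          with ((V s - 1) * (1 * u s + -1 * u' s) + u' s * (1 * V s + -1 * V' s)) by ring.
        eapply Rle_trans; [apply Rabs_triang|]. rewrite !Rabs_mult.
        assert (B1 : Rabs (V s - 1) <= K).
        { specialize (C3 s ltac:(lra)). apply Rcomplements.Rabs_le_between in C3.
          apply Rabs_le. unfold K; lra. }
        assert (B2 : Rabs (u' s) <= K) by (specialize (C2 s ltac:(lra)); unfold K; lra).
        pose proof (Rmult_le_compat _ _ _ _ (Rabs_pos _) (Rabs_pos _) B1 I1).
        pose proof (Rmult_le_compat _ _ _ _ (Rabs_pos _) (Rabs_pos _) B2 I2). lra.
      + apply (weighted_Rabs_le d _ l T _ _ _ r Hd Hl HM DV); [lra|lra|exact HrT|].
        intros s Hs. destruct (IH s ltac:(lra)) as [I1 I2].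
        replace (1 * u s ^ 2 + -1 * u' s ^ 2)
          with ((u s + u' s) * (1 * u s + -1 * u' s)) by ring.
        rewrite !Rabs_mult.
        assert (B1 : Rabs (u s + u' s) <= 2 * K).
        { specialize (C1 s ltac:(lra)). specialize (C2 s ltac:(lra)).
          pose proof (Rabs_triang (u s) (u' s)). unfold K; lra. }
        pose proof (Rmult_le_compat _ _ _ _ (Rabs_pos (u s + u' s))
          (Rabs_pos (1 * u s + -1 * u' s)) B1 I1). lra. }
  intros r Hr. split.
  - assert (1 * u r + -1 * u' r = 0); [|lra].
    apply (pow_half_le_0 _ (N * exp (l * r ^ 2))). intros n. destruct (Main n r Hr) as [I _]. lra.
  - assert (1 * V r + -1 * V' r = 0); [|lra].
    apply (pow_half_le_0 _ (N * exp (l * r ^ 2))). intros n. destruct (Main n r Hr) as [_ I]. lra.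
Qed.

Lemma continue_in_0_unique (T : Rbar) (f g : R -> R) :
  Rbar_lt (Finite 0) T -> continue_in f (interval T) 0 -> continue_in g (interval T) 0 ->
  (forall x, 0 < x -> Rbar_lt (Finite x) T -> f x = g x) -> f 0 = g 0.
Proof.
  intros HT Hf Hg E. destruct (Rbar_lt_near 0 T HT) as [b [Hb Hnear]].
  apply continue_in_lim0 in Hf, Hg; auto.
  assert (Hg' : lim0 f (g 0)).
  { apply (filterlim_ext_loc g); [|exact Hg].
    exists (mkposreal b Hb). intros x Hx Hpos. symmetry; apply E; [exact Hpos|exact (Hnear x Hx)]. }
  exact (filterlim_locally_unique f _ _ Hf Hg').
Qed.

Lemma is_derive_eq_near (f g : R -> R) (T : Rbar) (r a b : R) :
  0 < r -> Rbar_lt (Finite r) T ->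
  (forall x, 0 < x -> Rbar_lt (Finite x) T -> f x = g x) ->
  is_derive f r a -> is_derive g r b -> a = b.
Proof.
  intros Hr HT E Hf Hg.
  destruct (Rbar_lt_near r T HT) as [e [He Hnear]].
  assert (Hm : 0 < Rmin r e) by (apply Rmin_glb_lt; assumption).
  pose proof (Rmin_l r e). pose proof (Rmin_r r e).
  apply (is_derive_ext_loc f g) in Hf.
  - rewrite <- (is_derive_unique _ _ _ Hf). exact (is_derive_unique _ _ _ Hg).
  - exists (mkposreal _ Hm). intros y Hy. change (Rabs (y - r) < Rmin r e) in Hy.
    apply E; [apply Rabs_def2 in Hy; lra|apply Hnear; lra].
Qed.

Lemma C2_on_unique (T : Rbar) (f f1 f2 g g1 g2 : R -> R) :
  Rbar_lt (Finite 0) T -> C2_on (interval T) f f1 f2 -> C2_on (interval T) g g1 g2 ->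
  (forall r, 0 < r -> Rbar_lt (Finite r) T -> f r = g r) ->
  forall r, interval T r -> f r = g r /\ f1 r = g1 r /\ f2 r = g2 r.
Proof.
  intros HT Hf Hg E.
  assert (Hin : forall r, 0 < r -> Rbar_lt (Finite r) T -> interval T r)
    by (intros r Hr HrT; split; [lra|exact HrT]).
  assert (E1 : forall r, 0 < r -> Rbar_lt (Finite r) T -> f1 r = g1 r).
  { intros r Hr HrT. apply (is_derive_eq_near f g T r); auto.
    - apply D_in_is_derive with T; auto. apply (Hf r (Hin r Hr HrT)).
    - apply D_in_is_derive with T; auto. apply (Hg r (Hin r Hr HrT)). }
  assert (E2 : forall r, 0 < r -> Rbar_lt (Finite r) T -> f2 r = g2 r).
  { intros r Hr HrT. apply (is_derive_eq_near f1 g1 T r); auto.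
    - apply D_in_is_derive with T; auto. apply (Hf r (Hin r Hr HrT)).
    - apply D_in_is_derive with T; auto. apply (Hg r (Hin r Hr HrT)). }
  intros r [[Hr|<-] HrT]; [auto|].
  destruct (Hf 0 (conj (Rle_refl 0) HT)) as [D1 [D2 D3]].
  destruct (Hg 0 (conj (Rle_refl 0) HT)) as [G1 [G2 G3]].
  split; [|split]; apply (continue_in_0_unique T); auto; eapply cont_deriv; eassumption.
Qed.

Lemma solves_unique (d : R) (T : Rbar) (u u1 u2 V V1 V2 v v1 v2 W W1 W2 : R -> R) :
  0 < d -> Rbar_lt (Finite 0) T -> u 0 = v 0 ->
  solves d T u u1 u2 V V1 V2 -> solves d T v v1 v2 W W1 W2 ->
  forall r, interval T r ->
    (u r = v r /\ u1 r = v1 r /\ u2 r = v2 r) /\ (V r = W r /\ V1 r = W1 r /\ V2 r = W2 r).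
Proof.
  intros Hd HT E0 Hu Hv.
  destruct (solves_radial _ _ _ _ _ _ _ _ Hd HT Hu) as [Ru RV].
  destruct (solves_radial _ _ _ _ _ _ _ _ Hd HT Hv) as [Rv RW].
  destruct Hu as [U1 [U2 [_ [_ [U3 _]]]]]. destruct Hv as [V3 [V4 [_ [_ [V5 _]]]]].
  assert (E : forall r, 0 < r -> Rbar_lt (Finite r) T -> u r = v r /\ V r = W r).
  { intros r Hr HrT. apply (radial_system_unique d r T u u1 V V1 v v1 W W1); auto; lra. }
  intros r Hr. split; eapply C2_on_unique; eauto; intros s Hs HsT; apply (E s Hs HsT).
Qed.

Lemma is_solution_unique (d u0 : R) (T T' : Rbar) (u V u' V' : R -> R) :
  0 < d -> Rbar_le T' T -> is_solution d u0 T u V -> is_solution d u0 T' u' V' ->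
  forall r, interval T' r -> u r = u' r /\ V r = V' r.
Proof.
  intros Hd HT H H' r Hr.
  apply is_solution_solves in H as [H0 [E [u1 [u2 [V1 [V2 H]]]]]].
  apply is_solution_solves in H' as [H0' [E' [v1 [v2 [W1 [W2 H']]]]]].
  destruct (solves_unique d T' u u1 u2 V V1 V2 u' v1 v2 V' W1 W2 Hd H0') with r
    as [[A _] [B _]]; auto; [lra|]. exact (solves_restrict _ _ _ _ _ _ _ _ _ HT H).
Qed.

(** * Maximal solutions *)

(** Regularity relative to an interval is local: close enough to [r], all points of [interval T] lie
    in [interval T'], where [f] and [g] agree. This transfers regularity to a glued function. *)
Lemma C2_on_local (T T' : Rbar) (f f1 f2 g g1 g2 : R -> R) (r : R) :
  interval T' r -> C2_on (interval T') f f1 f2 ->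
  (forall x, interval T' x -> f x = g x /\ f1 x = g1 x /\ f2 x = g2 x) ->
  D_in g g1 (interval T) r /\ D_in g1 g2 (interval T) r /\ continue_in g2 (interval T) r.
Proof.
  intros Hr HC E. destruct (HC r Hr) as [H1 [H2 H3]]. destruct (E r Hr) as [F [F1 F2]].
  destruct Hr as [Hr HrT]. destruct (Rbar_lt_near r T' HrT) as [e [He Hnear]].
  unfold D_in, continue_in in *. rewrite F, F1, F2 in *.
  split; [|split]; intros eps Heps.
  - destruct (H1 eps Heps) as [a [Ha Hl]]. exists (Rmin a e). split; [apply Rmin_glb_lt; assumption|].
    intros x [[[Hx0 Hx1] Hx2] Hx]. pose proof (Rmin_l a e). pose proof (Rmin_r a e).
    assert (Hx' : interval T' x)
      by (split; [exact Hx0|apply Hnear; simpl in Hx; unfold Rdist in Hx; lra]).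
    destruct (E x Hx') as [<- _]. apply Hl. split; [split; auto|lra].
  - destruct (H2 eps Heps) as [a [Ha Hl]]. exists (Rmin a e). split; [apply Rmin_glb_lt; assumption|].
    intros x [[[Hx0 Hx1] Hx2] Hx]. pose proof (Rmin_l a e). pose proof (Rmin_r a e).
    assert (Hx' : interval T' x)
      by (split; [exact Hx0|apply Hnear; simpl in Hx; unfold Rdist in Hx; lra]).
    destruct (E x Hx') as [_ [<- _]]. apply Hl. split; [split; auto|lra].
  - destruct (H3 eps Heps) as [a [Ha Hl]]. exists (Rmin a e). split; [apply Rmin_glb_lt; assumption|].
    intros x [[[Hx0 Hx1] Hx2] Hx]. pose proof (Rmin_l a e). pose proof (Rmin_r a e).
    assert (Hx' : interval T' x)
      by (split; [exact Hx0|apply Hnear; simpl in Hx; unfold Rdist in Hx; lra]).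
    destruct (E x Hx') as [_ [_ <-]]. apply Hl. split; [split; auto|lra].
Qed.

(** A solution on a finite interval bundled with its derivatives, so that a single choice selects
    all six functions consistently. *)
Record germ := Germ { g_end : R; g_u : R -> R; g_u1 : R -> R; g_u2 : R -> R;
  g_V : R -> R; g_V1 : R -> R; g_V2 : R -> R }.

Definition good_germ (d u0 r : R) (g : germ) : Prop :=
  0 <= r < g_end g /\ g_u g 0 = u0 /\
  solves d (Finite (g_end g)) (g_u g) (g_u1 g) (g_u2 g) (g_V g) (g_V1 g) (g_V2 g).

Lemma good_germ_unique (d u0 r s x : R) (g k : germ) :
  0 < d -> good_germ d u0 r g -> good_germ d u0 s k -> 0 <= x < g_end g -> x < g_end k ->
  (g_u g x = g_u k x /\ g_u1 g x = g_u1 k x /\ g_u2 g x = g_u2 k x) /\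
  (g_V g x = g_V k x /\ g_V1 g x = g_V1 k x /\ g_V2 g x = g_V2 k x).
Proof.
  intros Hd [Hr [E H]] [Hs [E' H']] Hx Hxk.
  pose proof (Rmin_l (g_end g) (g_end k)) as Ml. pose proof (Rmin_r (g_end g) (g_end k)) as Mr.
  pose proof (Rmin_glb_lt _ _ _ (proj2 Hx) Hxk) as Mx.
  apply (solves_unique d (Finite (Rmin (g_end g) (g_end k)))); auto.
  - simpl; lra.
  - congruence.
  - exact (solves_restrict _ (Finite (g_end g)) (Finite _) _ _ _ _ _ _ Ml H).
  - exact (solves_restrict _ (Finite (g_end k)) (Finite _) _ _ _ _ _ _ Mr H').
  - split; [lra|exact Mx].
Qed.

(** The end [T] is the supremum of the lengths of solutions. At each [r < T] a solution reaching
    past [r] is chosen and evaluated at [r]; uniqueness makes the choices agree wherever they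
    overlap. *)
Lemma maximal_exists (d u0 : R) (T0 : Rbar) (u0' V0' : R -> R) :
  0 < d -> is_solution d u0 T0 u0' V0' ->
  exists (T : Rbar) (u V : R -> R), Rbar_le T0 T /\ is_maximal_solution d u0 T u V.
Proof.
  intros Hd Hsol.
  (* Lengths in [E] are finite; a global solution contributes all its restrictions, so that [T] is
     then [p_infty]. *)
  pose (E := fun t : R => exists g, g_end g = t /\ good_germ d u0 0 g).
  pose (T := Lub_Rbar E). destruct (Lub_Rbar_correct E) as [Hub Hlub]. fold T in Hub, Hlub.
  assert (Hgerm : forall t T' u V, is_solution d u0 T' u V -> 0 < t -> Rbar_le (Finite t) T' -> E t).
  { intros t T' u V H Ht HT.
    apply is_solution_solves in H as [_ [E0 [u1 [u2 [V1 [V2 H]]]]]].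
    exists (Germ t u u1 u2 V V1 V2). split; [reflexivity|]. split; [simpl; lra|split; [exact E0|]].
    exact (solves_restrict _ _ _ _ _ _ _ _ _ HT H). }
  assert (Hmax : forall T' u V, is_solution d u0 T' u V -> Rbar_le T' T).
  { intros T' u V H. pose proof (proj1 H) as Hpos.
    destruct T' as [t| |].
    - apply Hub. apply (Hgerm t (Finite t) u V H); [exact Hpos|apply Rbar_le_refl].
    - assert (HI : forall t, 0 < t -> Rbar_le (Finite t) T)
        by (intros t Ht; apply Hub; exact (Hgerm t p_infty u V H Ht I)).
      destruct T as [t| |]; simpl; auto.
      + specialize (HI (Rabs t + 1)). pose proof (Rabs_pos t). pose proof (Rle_abs t).
        specialize (HI ltac:(lra)). simpl in HI. lra.
      + exact (HI 1 Rlt_0_1).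
    - contradiction. }
  assert (Hpos : Rbar_lt (Finite 0) T)
    by (apply Rbar_lt_le_trans with T0; [exact (proj1 Hsol)|exact (Hmax _ _ _ Hsol)]).
  (* Membership of [r] is a premise inside the existential, so that choice yields a total function;
     outside the interval any germ serves. *)
  assert (Hex : forall r, exists g, interval T r -> good_germ d u0 r g).
  { intros r. destruct (classic (interval T r)) as [[Hr HrT]|Hn].
    - assert (Ht : exists t, E t /\ r < t).
      { apply NNPP; intros Hn. apply (Rbar_lt_not_le _ _ HrT). apply Hlub.
        intros t Ht. simpl. apply Rnot_lt_le. intros Hlt. apply Hn. exists t; auto. }
      destruct Ht as [t [[g [<- [Hg Hg']]] Hrt]]. exists g. intros _. split; [lra|exact Hg'].
    - exists (Germ 0 u0' u0' u0' u0' u0' u0'). intros Hr; contradiction. }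
  pose (F := fun r => proj1_sig (constructive_indefinite_description _ (Hex r))).
  assert (HF : forall r, interval T r -> good_germ d u0 r (F r))
    by (intros r; exact (proj2_sig (constructive_indefinite_description _ (Hex r)))).
  assert (HT : forall r x, interval T r -> interval (Finite (g_end (F r))) x -> interval T x).
  { intros r x Hr [Hx HxT]. split; [exact Hx|]. apply Rbar_lt_le_trans with (Finite (g_end (F r))).
    - exact HxT.
    - apply Hub. exists (F r). split; [reflexivity|]. destruct (HF r Hr) as [A B].
      split; [|exact B]. simpl in HxT. lra. }
  assert (HE : forall r x, interval T r -> interval (Finite (g_end (F r))) x ->
    (g_u (F r) x = g_u (F x) x /\ g_u1 (F r) x = g_u1 (F x) x /\ g_u2 (F r) x = g_u2 (F x) x) /\
    (g_V (F r) x = g_V (F x) x /\ g_V1 (F r) x = g_V1 (F x) x /\ g_V2 (F r) x = g_V2 (F x) x)).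
  { intros r x Hr Hx. pose proof (HF r Hr) as G. pose proof (HF x (HT r x Hr Hx)) as G'.
    apply (good_germ_unique d u0 r x); [exact Hd|exact G|exact G'|exact Hx|].
    destruct G' as [G' _]; lra. }
  exists T, (fun r => g_u (F r) r), (fun r => g_V (F r) r). split; [exact (Hmax _ _ _ Hsol)|].
  split; [|intros T' u V H _; exact (Hmax T' u V H)].
  assert (H0 : interval T 0) by (split; [lra|exact Hpos]).
  assert (Hloc : forall r, interval T r -> interval (Finite (g_end (F r))) r)
    by (intros r Hr; destruct (HF r Hr) as [A _]; exact A).
  split; [exact Hpos|].
  exists (fun r => g_u1 (F r) r), (fun r => g_u2 (F r) r),
    (fun r => g_V1 (F r) r), (fun r => g_V2 (F r) r).
  split; [|split; [|split]].
  - intros r Hr. destruct (HF r Hr) as [_ [_ [C _]]].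
    apply (C2_on_local T _ _ _ _ _ _ _ r (Hloc r Hr) C).
    intros x Hx. exact (proj1 (HE r x Hr Hx)).
  - intros r Hr. destruct (HF r Hr) as [_ [_ [_ [C _]]]].
    apply (C2_on_local T _ _ _ _ _ _ _ r (Hloc r Hr) C).
    intros x Hx. exact (proj2 (HE r x Hr Hx)).
  - intros r Hr HrT. assert (Hr' : interval T r) by (split; [lra|exact HrT]).
    destruct (HF r Hr') as [A [_ [_ [_ [C _]]]]]. apply C; [exact Hr|apply A].
  - destruct (HF 0 H0) as [A [B [_ [_ [_ [C [C' C'']]]]]]]. auto.
Qed.

(** * Existence by Picard iteration *)

(** The integrals below are differentiated under continuity on the whole line, so functions that
    matter only for [r > 0] are continued by a constant to the left of 0. *)
Lemma continuous_glue_const (f g : R -> R) (c : R) :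
  (forall x, x <= 0 -> f x = c) -> (forall x, 0 < x -> f x = g x) ->
  (forall x, 0 < x -> continuous g x) -> lim0 g c -> forall x, continuous f x.
Proof.
  intros Hn Hp Hg Hl x. destruct (Rtotal_order x 0) as [Hx|[->|Hx]].
  - apply continuous_ext_loc with (fun _ => c); [|apply continuous_const].
    assert (Hm : 0 < - x) by lra. exists (mkposreal _ Hm). intros y Hy. symmetry. apply Hn.
    change (Rabs (y - x) < - x) in Hy. apply Rabs_def2 in Hy. lra.
  - apply filterlim_locally. intros eps. rewrite Hn by lra.
    destruct (proj1 (lim0_spec _ _) Hl eps (cond_pos eps)) as [delta [Hd H]].
    exists (mkposreal delta Hd). intros y Hy. change (Rabs (y - 0) < delta) in Hy.
    rewrite Rminus_0_r in Hy. apply Rabs_def2 in Hy.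
    change (Rabs (f y - c) < eps). destruct (Rle_or_lt y 0) as [H0|H0].
    + rewrite Hn, Rminus_diag_eq, Rabs_R0 by auto. apply cond_pos.
    + rewrite Hp by assumption. apply H. lra.
  - apply continuous_ext_loc with g; [|auto].
    exists (mkposreal x Hx). intros y Hy. symmetry. apply Hp.
    change (Rabs (y - x) < x) in Hy. apply Rabs_def2 in Hy. lra.
Qed.

(* [Rpower 0 e] is the junk value 1, hence the case distinctions. *)
Definition root (d y : R) : R := if Rle_dec y 0 then 0 else Rpower y (/ d).

(* The substitution [y = s^d] turns [r^(-d) int_0^r h(s) s^(d-1) ds] into a proper
   integral also when [d < 1]. *)
Definition average (d : R) (h : R -> R) (r : R) : R :=
  if Rle_dec r 0 then h 0 / d
  else RInt (fun y => h (root d y)) 0 (Rpower r d) / Rpower r d / d.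

(** The solution with zero initial data, built from [f' r = r * average d h r]. Splitting off the
    factor [r] leaves a continuous average, equal to [h 0 / d] at 0, which makes [f] twice
    differentiable there as well. *)
Definition linsol (d : R) (h : R -> R) (r : R) : R := RInt (fun t => t * average d h t) 0 r.

Lemma root_continuous (d y : R) : 0 < d -> continuous (root d) y.
Proof.
  intros Hd. revert y. apply (continuous_glue_const _ (fun y => Rpower y (/ d)) 0).
  - intros x Hx. unfold root. destruct (Rle_dec x 0); [reflexivity|contradiction].
  - intros x Hx. unfold root. destruct (Rle_dec x 0); [lra|reflexivity].
  - intros x Hx. apply @ex_derive_continuous. eexists. apply is_derive_Rpower, Hx.
  - apply Rpower_lim0, Rinv_0_lt_compat, Hd.
Qed.

Lemma root_Rpower (d r : R) : 0 < d -> 0 < r -> root d (Rpower r d) = r.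
Proof.
  intros Hd Hr. assert (0 < Rpower r d) by apply exp_pos.
  unfold root. destruct (Rle_dec (Rpower r d) 0); [lra|].
  rewrite Rpower_mult, Rinv_r, Rpower_1; lra.
Qed.

Lemma is_derive_RInt_continuous (f : R -> R) (x : R) :
  (forall y, continuous f y) -> is_derive (fun y => RInt f 0 y) x (f x).
Proof.
  intros Hf. apply (is_derive_RInt f _ 0 x); [|apply Hf].
  apply filter_forall. intros y. apply @RInt_correct, @ex_RInt_continuous. auto.
Qed.

Section LinearEquation.

Variables (d : R) (h : R -> R).
Hypotheses (d_pos : 0 < d) (h_cont : forall x, continuous h x).

Let H (y : R) : R := RInt (fun y => h (root d y)) 0 y.

Lemma is_derive_moment (y : R) : is_derive H y (h (root d y)).
Proof.
  apply (is_derive_RInt_continuous (fun y => h (root d y))).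
  intros z. apply (continuous_comp (root d) h); [apply root_continuous, d_pos|apply h_cont].
Qed.

Lemma average_pos (r : R) : 0 < r -> average d h r = H (Rpower r d) / Rpower r d / d.
Proof. intros Hr. unfold average. destruct (Rle_dec r 0); [lra|reflexivity]. Qed.

Lemma average_0 : average d h 0 = h 0 / d.
Proof. unfold average. destruct (Rle_dec 0 0); [reflexivity|lra]. Qed.

Lemma is_derive_average (r : R) :
  0 < r -> is_derive (fun x => H (Rpower x d) / Rpower x d / d) r (h r / r - d / r * average d h r).
Proof.
  intros Hr. assert (Hp : 0 < Rpower r d) by apply exp_pos.
  assert (HH : is_derive (fun x => H (Rpower x d)) r (d / r * Rpower r d * h r)).
  { pose proof (is_derive_comp H (fun x => Rpower x d) r _ _
      (is_derive_moment (Rpower r d)) (is_derive_Rpower r d Hr)) as D.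
    rewrite root_Rpower in D by assumption. exact D. }
  pose proof (is_derive_Rpower r d Hr) as HP.
  pose proof (is_derive_div _ _ _ _ _ HH HP ltac:(lra)) as HD.
  pose proof (is_derive_scal _ _ (/ d) _ HD) as HS.
  evar_last.
  - apply (is_derive_ext (fun x => / d * (H (Rpower x d) / Rpower x d))); [|exact HS].
    intros t. unfold Rdiv.
    change (/ d * (H (Rpower t d) * / Rpower t d) = H (Rpower t d) * / Rpower t d * / d :> R). ring.
  - rewrite average_pos by assumption. cbv beta. field. repeat split; lra.
Qed.

(** At 0: with [y = r^d] the average is [H y / y / d], and [H y / y] is the difference quotient of
    [H] at 0, which tends to [h 0]. *)
Lemma average_continuous (r : R) : continuous (average d h) r.
Proof.
  revert r. apply (continuous_glue_const _ (fun x => H (Rpower x d) / Rpower x d / d) (h 0 / d)).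
  - intros x Hx. unfold average. destruct (Rle_dec x 0); [reflexivity|contradiction].
  - intros x Hx. apply average_pos, Hx.
  - intros x Hx. apply @ex_derive_continuous. eexists. apply is_derive_average, Hx.
  - assert (Hl : lim0 (fun y => H y / y) (h 0)).
    { apply lim0_spec. intros eps Heps.
      pose proof (is_derive_moment 0) as D. apply is_derive_Reals in D.
      destruct (D eps Heps) as [delta Hd]. exists delta. split; [apply cond_pos|].
      intros x Hx. specialize (Hd x ltac:(lra) ltac:(rewrite Rabs_pos_eq; lra)).
      replace (H 0) with 0 in Hd by (symmetry; exact (RInt_point 0 _)).
      rewrite Rplus_0_l, Rminus_0_r in Hd. unfold root in Hd.
      destruct (Rle_dec 0 0); [exact Hd|lra]. }
    eapply lim0_eq; [| |refine (lim0_scal (/ d) (fun x => H (Rpower x d) / Rpower x d) (h 0) _)].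
    + intros; cbv beta; unfold Rdiv; ring.
    + unfold Rdiv; ring.
    + apply lim0_spec. intros eps Heps.
      destruct (proj1 (lim0_spec _ _) Hl eps Heps) as [a [Ha Hla]].
      destruct (proj1 (lim0_spec _ _) (Rpower_lim0 d d_pos) a Ha) as [b [Hb Hlb]].
      exists b. split; [exact Hb|]. intros x Hx. apply Hla. specialize (Hlb x Hx).
      assert (0 < Rpower x d) by apply exp_pos. rewrite Rminus_0_r in Hlb. apply Rabs_def2 in Hlb. lra.
Qed.

Lemma is_derive_linsol (r : R) : is_derive (linsol d h) r (r * average d h r).
Proof.
  apply (is_derive_RInt_continuous (fun t => t * average d h t)).
  intros y. apply (continuous_mult (K := R_AbsRing) (fun t : R => t) (average d h) y);
    [apply continuous_id|apply average_continuous].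
Qed.

Lemma is_derive_linsol1 (r : R) : 0 <= r ->
  is_derive (fun t => t * average d h t) r (h r - (d - 1) * average d h r).
Proof.
  intros [Hr|<-].
  - apply (is_derive_ext_loc (fun t => t * (H (Rpower t d) / Rpower t d / d))).
    + exists (mkposreal r Hr). intros y Hy. change (Rabs (y - r) < r) in Hy. apply Rabs_def2 in Hy.
      rewrite average_pos by lra. reflexivity.
    + evar_last.
      * exact (is_derive_mult (fun t : R => t) (fun x => H (Rpower x d) / Rpower x d / d) r _ _
          (is_derive_id r) (is_derive_average r Hr) Rmult_comm).
      * unfold plus, mult, one; simpl. rewrite <- average_pos by exact Hr. field. lra.
  (* At 0 the difference quotient of [t * average d h t] is the average itself, so its continuity
     suffices; the value fits since [h 0 - (d - 1) * (h 0 / d) = h 0 / d]. *)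
  - replace (h 0 - (d - 1) * average d h 0) with (average d h 0) by (rewrite average_0; field; lra).
    apply is_derive_Reals. intros eps Heps.
    destruct (proj1 (filterlim_locally _ _) (average_continuous 0) (mkposreal eps Heps)) as [delta Hd].
    exists delta. intros x Hx0 Hx.
    replace (((0 + x) * average d h (0 + x) - 0 * average d h 0) / x) with (average d h x)
      by (rewrite Rplus_0_l; field; exact Hx0).
    apply (Hd x). change (Rabs (x - 0) < delta). rewrite Rminus_0_r. exact Hx.
Qed.

Lemma linsol_0 : linsol d h 0 = 0.
Proof. exact (RInt_point 0 _). Qed.

Lemma linsol_radial : radial d p_infty (linsol d h) (fun t => t * average d h t) h.
Proof.
  pose proof (lim0_continuous _ (average_continuous 0)) as Ha.
  split.
  - intros; apply is_derive_linsol.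
  - intros r Hr _.
    replace (h r - (d - 1) / r * (r * average d h r)) with (h r - (d - 1) * average d h r)
      by (field; lra).
    apply is_derive_linsol1. lra.
  - apply lim0_continuous, @ex_derive_continuous. eexists. apply is_derive_linsol.
  - eapply lim0_eq; [intros; reflexivity| |exact (lim0_mult _ _ _ _ lim0_id Ha)]. ring.
  - eapply lim0_eq; [| |exact (lim0_mult _ _ _ _ (Rpower_lim0 d d_pos) Ha)].
    + intros x Hx; cbv beta. rewrite (Rpower_split x d Hx). ring.
    + ring.
Qed.

End LinearEquation.

(** With [l = 2 / d] the norm [1 / (2 * d * l)] is 1/4; together with the Lipschitz constant 2 of
    the clamped square, the Picard map contracts by 1/2. *)
Lemma linsol_weighted (d M : R) (h k : R -> R) (r : R) :
  0 < d -> (forall x, continuous h x) -> (forall x, continuous k x) -> 0 <= M ->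
  (forall s, 0 <= s -> Rabs (h s - k s) <= M * exp (2 / d * s ^ 2)) -> 0 <= r ->
  Rabs (linsol d h r - linsol d k r) <= M / 4 * exp (2 / d * r ^ 2).
Proof.
  intros Hd Hh Hk HM Hhk [Hr|<-].
  - pose proof (radial_comb d 1 (-1) _ _ _ _ _ _ _ (linsol_radial d h Hd Hh)
      (linsol_radial d k Hd Hk)) as R.
    replace (linsol d h r - linsol d k r) with (1 * linsol d h r + -1 * linsol d k r) by ring.
    replace (M / 4) with (M / (2 * d * (2 / d))) by (field; lra).
    refine (weighted_Rabs_le d M (2 / d) p_infty _ _ _ r Hd _ HM R _ Hr I _).
    + apply Rdiv_lt_0_compat; lra.
    + rewrite !linsol_0. ring.
    + intros s Hs. specialize (Hhk s ltac:(lra)).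
      replace (1 * h s + -1 * k s) with (h s - k s) by ring. exact Hhk.
  - rewrite !linsol_0, Rminus_0_r, Rabs_R0. apply Rmult_le_pos; [lra|left; apply exp_pos].
Qed.

(** The truncation makes the square globally Lipschitz. A solution starting from 1 never exceeds the
    upper bound; the lower one is negative to leave room for a crossing of zero. *)
Definition clamp (x : R) : R := Rmax (-1) (Rmin 1 x).

Lemma clamp_id (x : R) : -1 <= x <= 1 -> clamp x = x.
Proof. intros H. unfold clamp. rewrite Rmin_right, Rmax_right; lra. Qed.

Lemma clamp_sqr_lipschitz (x y : R) : Rabs (- clamp x ^ 2 - - clamp y ^ 2) <= 2 * Rabs (x - y).
Proof.
  unfold clamp, Rmax, Rmin.
  apply Rabs_le.
  destruct (Rle_dec 1 x), (Rle_dec 1 y); repeat destruct Rle_dec;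
    unfold Rabs; destruct Rcase_abs; try lra; split; nra.
Qed.

Fixpoint picard (d : R) (n : nat) : R -> R :=
  match n with
  | O => fun _ => 1
  | S m => fun r => 1 + linsol d (fun s => - clamp (picard d m s) ^ 2) r
  end.

Lemma clamp_sqr_continuous (f : R -> R) (x : R) :
  continuous f x -> continuous (fun s => - clamp (f s) ^ 2) x.
Proof.
  intros H. apply filterlim_locally. intros eps.
  assert (He : 0 < eps / 2) by (pose proof (cond_pos eps); lra).
  apply (filter_imp (fun s => Rabs (f s - f x) < eps / 2)).
  - intros s Hs. change (Rabs (- clamp (f s) ^ 2 - - clamp (f x) ^ 2) < eps).
    pose proof (clamp_sqr_lipschitz (f s) (f x)). lra.
  - exact (proj1 (filterlim_locally _ _) H (mkposreal _ He)).
Qed.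

Lemma picard_continuous (d : R) (n : nat) (x : R) : 0 < d -> continuous (picard d n) x.
Proof.
  intros Hd. revert x. induction n as [|n IH]; intros x; simpl.
  - apply continuous_const.
  - apply (continuous_plus (fun _ => 1)); [apply continuous_const|].
    apply @ex_derive_continuous. eexists. apply is_derive_linsol; [exact Hd|].
    intros y. apply clamp_sqr_continuous, IH.
Qed.

Lemma picard_step (d r : R) (n : nat) : 0 < d -> 0 <= r ->
  Rabs (picard d (S n) r - picard d n r) <= (1 / 2) ^ n * exp (2 / d * r ^ 2).
Proof.
  intros Hd. revert r. induction n as [|n IH]; intros r Hr.
  - change (picard d 1 r - picard d 0 r) with (1 + linsol d (fun _ => - clamp 1 ^ 2) r - 1).
    change ((1 / 2) ^ 0) with 1.
    pose proof (linsol_weighted d 1 (fun s => - clamp 1 ^ 2) (fun _ => 0) r Hd) as B.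
    assert (E0 : linsol d (fun _ => 0) r = 0).
    { assert (Z : forall a b : R, RInt (fun _ => 0) a b = 0)
        by (intros; rewrite RInt_const; apply Rmult_0_r).
      assert (A : forall x, x * average d (fun _ => 0) x = 0).
      { intros x. unfold average. destruct (Rle_dec x 0); [|rewrite Z]; unfold Rdiv; ring. }
      unfold linsol. rewrite (RInt_ext _ (fun _ => 0)).
      - apply Z.
      - intros x _. apply A. }
    rewrite E0 in B.
    replace (1 + linsol d (fun _ => - clamp 1 ^ 2) r - 1) with (linsol d (fun _ => - clamp 1 ^ 2) r - 0) by ring.
    assert (Hexp : forall s, 0 <= s -> 1 <= exp (2 / d * s ^ 2)).
    { intros s Hs. rewrite <- exp_0. apply exp_le_compat. apply Rmult_le_pos; [|apply pow2_ge_0].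
      apply Rcomplements.Rdiv_le_0_compat; lra. }
    pose proof (Hexp r Hr) as Hr1.
    eapply Rle_trans; [apply B|]; try lra.
    + intros; apply continuous_const.
    + intros; apply continuous_const.
    + intros s Hs. rewrite clamp_id by lra. specialize (Hexp s Hs).
      replace (- 1 ^ 2 - 0) with (-1) by ring. rewrite Rabs_left; lra.
  - replace (picard d (S (S n)) r - picard d (S n) r)
      with (linsol d (fun s => - clamp (picard d (S n) s) ^ 2) r
            - linsol d (fun s => - clamp (picard d n s) ^ 2) r) by (simpl; ring).
    replace ((1 / 2) ^ S n) with (2 * (1 / 2) ^ n / 4) by (simpl; field).
    assert (Hp : 0 < (1 / 2) ^ n) by (apply pow_lt; lra).
    apply linsol_weighted; auto; [| |lra|].
    + intros x; apply clamp_sqr_continuous, picard_continuous, Hd.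
    + intros x; apply clamp_sqr_continuous, picard_continuous, Hd.
    + intros s Hs. specialize (IH s Hs).
      pose proof (clamp_sqr_lipschitz (picard d (S n) s) (picard d n s)). lra.
Qed.

Lemma picard_cauchy (d r : R) (n k : nat) : 0 < d -> 0 <= r ->
  Rabs (picard d (n + k) r - picard d n r) <= 2 * (1 / 2) ^ n * exp (2 / d * r ^ 2).
Proof.
  intros Hd Hr. pose proof (exp_pos (2 / d * r ^ 2)) as He.
  (* The exact partial geometric sum is carried along; the final bound alone is not inductive. *)
  enough (Rabs (picard d (n + k) r - picard d n r)
    <= (2 * (1 / 2) ^ n - 2 * (1 / 2) ^ (n + k)) * exp (2 / d * r ^ 2)).
  { assert (0 < (1 / 2) ^ (n + k)) by (apply pow_lt; lra). nra. }
  induction k as [|k IH].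
  - rewrite Nat.add_0_r, Rminus_diag_eq, Rabs_R0 by reflexivity. right; ring.
  - rewrite Nat.add_succ_r.
    pose proof (picard_step d r (n + k) Hd Hr) as St.
    replace (picard d (S (n + k)) r - picard d n r)
      with ((picard d (S (n + k)) r - picard d (n + k) r) + (picard d (n + k) r - picard d n r)) by ring.
    eapply Rle_trans; [apply Rabs_triang|].
    replace ((1 / 2) ^ S (n + k)) with ((1 / 2) ^ (n + k) / 2) by (simpl; field). lra.
Qed.

Lemma pow_half_small (K eps : R) : 0 < eps -> exists N, forall n, (N <= n)%nat -> K * (1 / 2) ^ n < eps.
Proof.
  intros He. pose proof (Rabs_pos K) as HK.
  destruct (pow_lt_1_zero (1 / 2) ltac:(rewrite Rabs_pos_eq; lra) (eps / (Rabs K + 1))) as [N HN].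
  - apply Rdiv_lt_0_compat; lra.
  - exists N. intros n Hn. specialize (HN n Hn).
    assert (Hp : 0 < (1 / 2) ^ n) by (apply pow_lt; lra). rewrite Rabs_pos_eq in HN by lra.
    apply Rmult_lt_compat_l with (r := Rabs K + 1) in HN; [|lra].
    replace ((Rabs K + 1) * (eps / (Rabs K + 1))) with eps in HN by (field; lra).
    pose proof (Rle_abs K). nra.
Qed.

(** The weight is bounded on bounded intervals, so the convergence is locally uniform and continuity
    passes to the limit. *)
Lemma picard_limit (d : R) : 0 < d -> exists L : R -> R,
  (forall x, continuous L x) /\
  forall n r, 0 <= r -> Rabs (L r - picard d n r) <= 2 * (1 / 2) ^ n * exp (2 / d * r ^ 2).
Proof.
  intros Hd.
  assert (Hcv : forall r, exists l, 0 <= r -> is_lim_seq (fun n => picard d n r) (Finite l)).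
  { intros r. destruct (Rle_or_lt 0 r) as [Hr|Hr]; [|exists 0; lra].
    destruct (proj2 (ex_lim_seq_cauchy_corr (fun n => picard d n r))) as [l Hl]; [|exists l; auto].
    intros eps.
    destruct (pow_half_small (2 * exp (2 / d * r ^ 2)) (eps / 2)) as [N HN];
      [pose proof (cond_pos eps); lra|].
    exists N. intros n m Hn Hm. specialize (HN N (le_n N)).
    pose proof (picard_cauchy d r N (n - N) Hd Hr) as C1.
    pose proof (picard_cauchy d r N (m - N) Hd Hr) as C2.
    replace (N + (n - N))%nat with n in C1 by lia. replace (N + (m - N))%nat with m in C2 by lia.
    apply Rcomplements.Rabs_le_between in C1, C2. apply Rabs_def1; lra. }
  pose (l := fun r => proj1_sig (constructive_indefinite_description _ (Hcv r))).
  assert (Hl : forall r, 0 <= r -> is_lim_seq (fun n => picard d n r) (Finite (l r)))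
    by (intros r; exact (proj2_sig (constructive_indefinite_description _ (Hcv r)))).
  assert (Hb : forall n r, 0 <= r ->
    Rabs (l r - picard d n r) <= 2 * (1 / 2) ^ n * exp (2 / d * r ^ 2)).
  { intros n r Hr.
    assert (Hlim : is_lim_seq (fun k => Rabs (picard d (n + k) r - picard d n r))
      (Finite (Rabs (l r - picard d n r)))).
    { apply (is_lim_seq_abs _ (Finite (l r - picard d n r))).
      apply (is_lim_seq_minus' _ _ (l r) (picard d n r)); [|apply is_lim_seq_const].
      apply (is_lim_seq_ext (fun k => picard d (k + n) r)); [intros k; f_equal; lia|].
      apply (is_lim_seq_incr_n (fun k => picard d k r)), Hl, Hr. }
    refine (is_lim_seq_le _ _ (Finite _) (Finite _) _ Hlim (is_lim_seq_const _)).
    intros k. apply picard_cauchy; assumption. }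
  (* The iteration is controlled only for [r >= 0]; the even reflection makes the limit continuous
     on the whole line, as [linsol] requires. *)
  exists (fun r => l (Rabs r)). split.
  - intros x. apply filterlim_locally. intros eps.
    destruct (pow_half_small (2 * exp (2 / d * (Rabs x + 1) ^ 2)) (eps / 3)) as [N HN];
      [pose proof (cond_pos eps); lra|]. specialize (HN N (le_n N)).
    assert (He : 0 < eps / 3) by (pose proof (cond_pos eps); lra).
    assert (Hc : continuous (fun r => picard d N (Rabs r)) x).
    { apply (continuous_comp Rabs (picard d N)); [apply continuous_Rabs|apply picard_continuous, Hd]. }
    apply (filter_imp (fun y => Rabs (picard d N (Rabs y) - picard d N (Rabs x)) < eps / 3
                            /\ Rabs (y - x) < 1)).
    + intros y [H1 H2]. change (Rabs (l (Rabs y) - l (Rabs x)) < eps).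
      assert (Hw : forall z, Rabs z <= Rabs x + 1 -> Rabs (l (Rabs z) - picard d N (Rabs z)) < eps / 3).
      { intros z Hz. pose proof (Rabs_pos z) as Hz0.
        eapply Rle_lt_trans; [apply Hb, Hz0|]. eapply Rle_lt_trans; [|exact HN].
        assert (0 < (1 / 2) ^ N) by (apply pow_lt; lra).
        rewrite (Rmult_assoc 2), (Rmult_assoc 2), (Rmult_comm (exp _)).
        apply Rmult_le_compat_l; [lra|]. apply Rmult_le_compat_l; [lra|].
        apply exp_le_compat, Rmult_le_compat_l; [apply Rcomplements.Rdiv_le_0_compat; lra|].
        apply pow_incr. lra. }
      pose proof (Rabs_triang_inv y x).
      pose proof (Hw y ltac:(lra)) as W1. pose proof (Hw x ltac:(lra)) as W2.
      apply Rabs_def2 in H1, W1, W2. apply Rabs_def1; lra.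
    + apply filter_and.
      * exact (proj1 (filterlim_locally _ _) Hc (mkposreal _ He)).
      * exists (mkposreal 1 Rlt_0_1). intros y Hy. exact Hy.
  - intros n r Hr. rewrite (Rabs_pos_eq r) by exact Hr. apply Hb, Hr.
Qed.

Lemma clamped_exists (d : R) : 0 < d -> exists f f1 f2 : R -> R,
  f 0 = 1 /\ f1 0 = 0 /\
  (forall r, 0 <= r -> is_derive f r (f1 r) /\ is_derive f1 r (f2 r) /\ continuous f2 r) /\
  (forall r, 0 < r -> f2 r + (d - 1) / r * f1 r = - clamp (f r) ^ 2).
Proof.
  intros Hd. destruct (picard_limit d Hd) as [L [HL HLn]].
  pose (h := fun s => - clamp (L s) ^ 2).
  assert (Hh : forall x, continuous h x) by (intros x; apply clamp_sqr_continuous, HL).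
  (* [L] is a fixed point: for every [n], both [1 + linsol d h] and [L] are within [(1 / 2) ^ n]
     times the weight of [picard d (S n)]. *)
  assert (E : forall r, 0 <= r -> 1 + linsol d h r = L r).
  { intros r Hr. apply Rminus_diag_uniq.
    apply (pow_half_le_0 _ (2 * exp (2 / d * r ^ 2))). intros n.
    assert (Hp : 0 < (1 / 2) ^ n) by (apply pow_lt; lra).
    assert (B : Rabs (linsol d h r - linsol d (fun s => - clamp (picard d n s) ^ 2) r)
      <= 4 * (1 / 2) ^ n / 4 * exp (2 / d * r ^ 2)).
    { apply linsol_weighted; auto; [|lra|].
      - intros x; apply clamp_sqr_continuous, picard_continuous, Hd.
      - intros s Hs. specialize (HLn n s Hs).
        pose proof (clamp_sqr_lipschitz (L s) (picard d n s)). unfold h. lra. }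
    pose proof (HLn (S n) r Hr) as B'. rewrite <- tech_pow_Rmult in B'.
    change (picard d (S n) r) with (1 + linsol d (fun s => - clamp (picard d n s) ^ 2) r) in B'.
    replace (1 + linsol d h r - L r) with
      ((linsol d h r - linsol d (fun s => - clamp (picard d n s) ^ 2) r)
       - (L r - (1 + linsol d (fun s => - clamp (picard d n s) ^ 2) r))) by ring.
    unfold Rminus at 1. eapply Rle_trans; [apply Rabs_triang|]. rewrite Rabs_Ropp. lra. }
  exists (fun r => 1 + linsol d h r), (fun r => r * average d h r),
    (fun r => h r - (d - 1) * average d h r).
  split; [|split; [|split]].
  - rewrite linsol_0. ring.
  - ring.
  - intros r Hr. split; [|split].
    + evar_last.
      * apply (is_derive_plus (fun _ => 1)); [apply @is_derive_const|apply is_derive_linsol; assumption].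
      * unfold plus, zero; simpl; ring.
    + apply is_derive_linsol1; assumption.
    + apply (continuous_minus h); [apply Hh|].
      apply (continuous_mult (K := R_AbsRing) (fun _ : R => d - 1) (average d h) r);
        [apply continuous_const|apply average_continuous; assumption].
  - intros r Hr. rewrite E by lra. unfold h. field. lra.
Qed.

(** * The Lane-Emden equation *)

Lemma C2_on_of_derive (T : Rbar) (f f1 f2 : R -> R) :
  (forall r, 0 <= r -> is_derive f r (f1 r) /\ is_derive f1 r (f2 r) /\ continuous f2 r) ->
  C2_on (interval T) f f1 f2.
Proof.
  intros H r [Hr _]. destruct (H r Hr) as [H1 [H2 H3]].
  split; [|split]; [apply is_derive_D_in, H1|apply is_derive_D_in, H2|apply continuous_continue_in, H3].
Qed.

(** The end [T] is left open: for [d < 6] the untruncated equation is available only as long as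
    [f >= -1], while [f] itself is differentiable on the whole half-line. *)
Lemma diagonal_solution (d : R) (T : Rbar) (f f1 f2 : R -> R) :
  Rbar_lt (Finite 0) T -> f 0 = 1 -> f1 0 = 0 ->
  (forall r, 0 <= r -> is_derive f r (f1 r) /\ is_derive f1 r (f2 r) /\ continuous f2 r) ->
  (forall r, 0 < r -> Rbar_lt (Finite r) T -> f2 r + (d - 1) / r * f1 r = - f r ^ 2) ->
  is_solution d 1 T f (fun r => 1 - f r).
Proof.
  intros HT H0 H1 HD HE. split; [exact HT|].
  exists f1, f2, (fun r => - f1 r), (fun r => - f2 r).
  split; [|split; [|split]].
  - apply C2_on_of_derive, HD.
  - apply C2_on_of_derive. intros r Hr. destruct (HD r Hr) as [D1 [D2 D3]].
    split; [|split].
    + evar_last; [apply (is_derive_minus (fun _ => 1) f r); [apply @is_derive_const|exact D1]|].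
      unfold minus, plus, zero, opp; simpl; ring.
    + exact (is_derive_opp _ _ _ D2).
    + exact (continuous_opp _ _ D3).
  - intros r Hr HrT. specialize (HE r Hr HrT). split; [rewrite HE; ring|].
    replace (f r ^ 2) with (- - f r ^ 2) by ring. rewrite <- HE. ring.
  - rewrite H0, H1. repeat split; ring.
Qed.

(** Continuity at 0 is known only from the right, so the intermediate value theorem is applied from
    a small positive point where [f] is still above [c]. *)
Lemma radial_ivt (d c r : R) (T : Rbar) (f f1 h : R -> R) :
  radial d T f f1 h -> c < f 0 -> 0 < r -> Rbar_lt (Finite r) T -> f r <= c ->
  exists z, 0 < z <= r /\ f z = c.
Proof.
  intros H H0 Hr HT [Hc|Hc]; [|exists r; split; [lra|exact Hc]].
  destruct (proj1 (lim0_spec _ _) (rad_l H) (f 0 - c)) as [delta [Hd Hx]]; [lra|].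
  pose proof (Rmin_l delta r). pose proof (Rmin_r delta r).
  assert (Hm : 0 < Rmin delta r) by (apply Rmin_glb_lt; assumption).
  specialize (Hx (Rmin delta r / 2) ltac:(lra)). apply Rabs_def2 in Hx.
  destruct (Ranalysis5.IVT_interv (fun x => c - f x) (Rmin delta r / 2) r) as [z [Hz E]]; try lra.
  - intros a Ha. apply continuity_pt_filterlim.
    apply (continuous_minus (fun _ => c) f); [apply continuous_const|].
    apply @ex_derive_continuous. exists (f1 a). apply (rad_d H); [lra|].
    apply Rbar_le_lt with r; [lra|exact HT].
  - exists z. split; lra.
Qed.

Lemma radial_antitone (d a b : R) (T : Rbar) (f f1 h : R -> R) :
  radial d T f f1 h -> 0 < a <= b -> Rbar_lt (Finite b) T ->
  (forall r, a < r < b -> f1 r <= 0) -> f b <= f a.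
Proof.
  intros H Hab HT Hf. apply (antitone f f1); [lra| |exact Hf].
  intros x Hx. apply (rad_d H); [lra|]. apply Rbar_le_lt with b; [lra|exact HT].
Qed.

(** Strictness comes from a neighbourhood of 0, where [h <= a / 2 < 0] makes the flux negative; from
    there on the flux cannot increase. *)
Lemma derivative_neg (d : R) (T : Rbar) (f f1 h : R -> R) (a r : R) :
  0 < d -> radial d T f f1 h -> 0 < r -> Rbar_lt (Finite r) T ->
  (forall s, 0 < s < r -> h s <= 0) -> lim0 h a -> a < 0 -> f1 r < 0.
Proof.
  intros Hd H Hr HT Hh Ha Hneg.
  destruct (proj1 (lim0_spec _ _) Ha (- a / 2)) as [delta [Hdel Hx]]; [lra|].
  pose proof (Rmin_l delta r). pose proof (Rmin_r delta r).
  assert (Hm : 0 < Rmin delta r) by (apply Rmin_glb_lt; assumption).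
  pose (x := Rmin delta r / 2).
  assert (Hxr : 0 < x < r) by (unfold x; lra).
  assert (HxT : Rbar_lt (Finite x) T) by (apply Rbar_le_lt with r; [lra|exact HT]).
  assert (f1 x <= a / 2 / d * x).
  { apply (derivative_le d (a / 2) T f f1 h x Hd H); [lra|exact HxT|].
    intros s Hs. unfold x in Hs. specialize (Hx s ltac:(lra)). apply Rabs_def2 in Hx. lra. }
  assert (a / 2 / d * x < 0).
  { assert (0 < - a / 2 / d) by (apply Rdiv_lt_0_compat; lra).
    replace (a / 2 / d) with (- (- a / 2 / d)) by (field; lra). nra. }
  pose proof (flux_antitone d T f f1 h x r H ltac:(lra) HT) as F.
  specialize (F ltac:(intros s Hs; apply Hh; lra)).
  assert (0 < Rpower x (d - 1)) by apply exp_pos. assert (0 < Rpower r (d - 1)) by apply exp_pos.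
  nra.
Qed.

(** The mean value theorem on [r, 2r] gives [c] with [- f1 c * r = f r - f (2 * r) <= f r], and the
    monotone flux carries this bound back from [c] to [r] at the cost of a ratio of weights. *)
Lemma derivative_doubling (d : R) (f f1 h : R -> R) (r : R) :
  0 < d -> radial d p_infty f f1 h -> 0 < r ->
  (forall s, 0 < s -> h s <= 0) -> (forall s, 0 < s -> 0 <= f s) ->
  - f1 r * r <= Rpower 2 d * f r.
Proof.
  intros Hd H Hr Hh Hf.
  destruct (MVT_cor2 f f1 r (2 * r)) as [c [E Hc]]; [lra| |].
  { intros c Hc. apply is_derive_Reals, (rad_d H); [lra|exact I]. }
  pose proof (flux_antitone d p_infty f f1 h r c H ltac:(lra) I) as F.
  specialize (F ltac:(intros s Hs; apply Hh; lra)).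
  assert (Wr : 0 < Rpower r (d - 1)) by apply exp_pos.
  assert (Wc : 0 < Rpower c (d - 1)) by apply exp_pos.
  (* Using [c^d <= (2 r)^d] and [c >= r] bounds the ratio of weights without distinguishing [d >= 1]
     from [d < 1]. *)
  assert (B : Rpower c (d - 1) <= Rpower 2 d * Rpower r (d - 1)).
  { apply Rmult_le_reg_l with r; [exact Hr|].
    apply Rle_trans with (c * Rpower c (d - 1)); [apply Rmult_le_compat_r; lra|].
    rewrite <- Rpower_split by lra.
    apply Rle_trans with (Rpower (2 * r) d); [apply Rle_Rpower_l; lra|].
    rewrite <- Rpower_mult_distr, (Rpower_split r d) by lra. right; ring. }
  pose proof (Hf (2 * r) ltac:(lra)). pose proof (Hf r Hr).
  apply Rmult_le_reg_l with (Rpower r (d - 1)); [exact Wr|].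
  apply Rle_trans with (Rpower c (d - 1) * (f r - f (2 * r))).
  - replace (f r - f (2 * r)) with (- f1 c * r) by (rewrite <- (Ropp_involutive (f r - f (2*r)));
      replace (- (f r - f (2 * r))) with (f (2 * r) - f r) by ring; rewrite E; ring).
    nra.
  - apply Rle_trans with (Rpower c (d - 1) * f r); [apply Rmult_le_compat_l; lra|].
    replace (Rpower r (d - 1) * (Rpower 2 d * f r)) with (Rpower 2 d * Rpower r (d - 1) * f r) by ring.
    apply Rmult_le_compat_r; assumption.
Qed.

(** * The Pohozaev function of the Lane-Emden equation *)

Definition pohozaev (d : R) (f f1 : R -> R) (r : R) : R :=
  Rpower r (d - 1) * (r * (f1 r ^ 2 / 2 + f r ^ 3 / 3) + (d - 2) / 2 * f r * f1 r).

(** The multiplier [(d - 2) / 2] is what cancels the terms in [f1^2]; the cubic terms leave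
    [d / 3 - (d - 2) / 2 = (6 - d) / 6]. *)
Lemma pohozaev_derive (d : R) (T : Rbar) (f f1 h : R -> R) (r : R) :
  radial d T f f1 h -> 0 < r -> Rbar_lt (Finite r) T -> h r = - f r ^ 2 ->
  is_derive (pohozaev d f f1) r (Rpower r (d - 1) * f r ^ 3 * ((6 - d) / 6)).
Proof.
  intros H Hr HT Hh.
  pose proof (rad_d H r Hr HT) as D. pose proof (rad_d1 H r Hr HT) as D1. rewrite Hh in D1.
  pose (W := fun x => Rpower x (d - 1)).
  assert (DW : is_derive W r ((d - 1) / r * W r)) by exact (is_derive_Rpower r (d - 1) Hr).
  unfold pohozaev.
  change (is_derive (fun x => W x * (x * (f1 x ^ 2 / 2 + f x ^ 3 / 3) + (d - 2) / 2 * f x * f1 x)) r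
    (W r * f r ^ 3 * ((6 - d) / 6))).
  clearbody W.
  auto_derive.
  - assert (ex_derive W r /\ ex_derive f r /\ ex_derive f1 r)
      by (split; [eexists; exact DW|split; [eexists; exact D|eexists; exact D1]]).
    tauto.
  - change (fun x : R => W x) with W. change (fun x : R => f x) with f.
    change (fun x : R => f1 x) with f1.
    rewrite (is_derive_unique _ _ _ D), (is_derive_unique _ _ _ D1), (is_derive_unique _ _ _ DW).
    field. lra.
Qed.

(** In each term containing [f1] the weight is absorbed into a flux, because [r^(d-1)] alone is
    unbounded when [d < 1]. *)
Lemma pohozaev_lim0 (d : R) (T : Rbar) (f f1 h : R -> R) :
  0 < d -> radial d T f f1 h -> lim0 (pohozaev d f f1) 0.
Proof.
  intros Hd H. pose proof (rad_l H) as L. pose proof (rad_l1 H) as L1. pose proof (rad_lflux H) as LF.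
  pose proof (Rpower_lim0 d Hd) as LP.
  eapply lim0_eq; [| |exact (lim0_plus _ _ _ _
    (lim0_plus _ _ _ _ (lim0_mult _ _ _ _ lim0_id (lim0_mult _ _ _ _ LF (lim0_scal (/ 2) _ _ L1)))
      (lim0_mult _ _ _ _ LP (lim0_scal (/ 3) _ _ (lim0_mult _ _ _ _ L (lim0_mult _ _ _ _ L L)))))
    (lim0_mult _ _ _ _ LF (lim0_scal ((d - 2) / 2) _ _ L)))].
  - intros x Hx. cbv beta. unfold pohozaev. rewrite (Rpower_split x d Hx). field.
  - ring.
Qed.

Section LaneEmden.

Variables (d : R) (f f1 : R -> R).
Hypotheses (d_pos : 0 < d) (f_0 : f 0 = 1)
  (f_rad : radial d p_infty f f1 (fun r => - clamp (f r) ^ 2)).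

Lemma emden_rhs_nonpos (r : R) : - clamp (f r) ^ 2 <= 0.
Proof. pose proof (pow2_ge_0 (clamp (f r))). lra. Qed.

Lemma emden_derive_neg (r : R) : 0 < r -> f1 r < 0.
Proof.
  intros Hr. apply (derivative_neg d p_infty f f1 _ (- clamp 1 ^ 2) r d_pos f_rad Hr I).
  - intros; apply emden_rhs_nonpos.
  - rewrite <- f_0. apply lim0_spec. intros eps Heps.
    destruct (proj1 (lim0_spec _ _) (rad_l f_rad) (eps / 2)) as [delta [Hd Hx]]; [lra|].
    exists delta. split; [exact Hd|]. intros x Hb. specialize (Hx x Hb).
    pose proof (clamp_sqr_lipschitz (f x) (f 0)). lra.
  - rewrite clamp_id; lra.
Qed.

Lemma emden_le_1 (r : R) : 0 < r -> f r <= 1.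
Proof.
  intros Hr. pose proof (value_le d 0 p_infty f f1 _ r d_pos f_rad Hr I) as B.
  rewrite f_0 in B. replace (0 / d * r ^ 2 / 2) with 0 in B by (field; lra).
  rewrite Rplus_0_r in B. apply B. intros; apply emden_rhs_nonpos.
Qed.

Lemma emden_antitone (a b : R) : 0 < a <= b -> f b <= f a.
Proof.
  intros Hab. apply (radial_antitone d a b p_infty f f1 _ f_rad Hab I).
  intros r Hr. left; apply emden_derive_neg; lra.
Qed.

Lemma emden_decreasing (a b : R) : 0 < a < b -> f b < f a.
Proof.
  intros Hab. destruct (MVT_cor2 f f1 a b) as [c [E Hc]]; [lra| |].
  - intros c Hc. apply is_derive_Reals, (rad_d f_rad); [lra|exact I].
  - pose proof (emden_derive_neg c ltac:(lra)). nra.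
Qed.

Lemma emden_rhs_unclamped (r : R) : 0 < r -> -1 <= f r -> - clamp (f r) ^ 2 = - f r ^ 2.
Proof. intros Hr H. rewrite clamp_id; [reflexivity|]. split; [exact H|apply emden_le_1, Hr]. Qed.

Lemma emden_pos_supercritical (r : R) : 6 <= d -> 0 < r -> 0 < f r.
Proof.
  intros Hd Hr. apply Rnot_le_lt. intros Hle.
  destruct (radial_ivt d 0 r p_infty f f1 _ f_rad ltac:(lra) Hr I Hle) as [z [Hz E]].
  assert (Hpos : forall x, 0 < x <= z -> 0 <= f x)
    by (intros x Hx; rewrite <- E; apply emden_antitone; lra).
  assert (P : pohozaev d f f1 z <= 0).
  { apply (antitone_lim0 _ (fun x => Rpower x (d - 1) * f x ^ 3 * ((6 - d) / 6)) z 0); [lra| | |].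
    - intros x Hx. apply (pohozaev_derive d p_infty f f1 _ x f_rad); [lra|exact I|].
      apply emden_rhs_unclamped; [lra|]. specialize (Hpos x Hx). lra.
    - intros x Hx. assert (0 < Rpower x (d - 1)) by apply exp_pos.
      pose proof (pow_le (f x) 3 (Hpos x ltac:(lra))).
      assert (0 <= Rpower x (d - 1) * f x ^ 3) by (apply Rmult_le_pos; lra). nra.
    - exact (pohozaev_lim0 d p_infty f f1 _ d_pos f_rad). }
  unfold pohozaev in P. rewrite E in P.
  assert (0 < Rpower z (d - 1)) by apply exp_pos. pose proof (emden_derive_neg z ltac:(lra)).
  assert (0 < f1 z ^ 2) by nra.
  assert (0 < Rpower z (d - 1) * (z * f1 z ^ 2)) by (apply Rmult_lt_0_compat; [|apply Rmult_lt_0_compat]; lra).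
  nra.
Qed.

(** While [f >= eps], the right-hand side is at most [- eps^2], and the resulting bound
    [f <= 1 - eps^2 r^2 / (2 d)] becomes negative. *)
Lemma emden_small (eps : R) : 0 < eps -> (forall r, 0 < r -> 0 <= f r) -> exists r, 0 < r /\ f r < eps.
Proof.
  intros Heps Hf. apply NNPP. intros Hn.
  assert (Hge : forall r, 0 < r -> eps <= f r).
  { intros r Hr. apply Rnot_lt_le. intros Hlt. apply Hn. exists r; auto. }
  (* Here [eps^2 / d * x = 4] and [(1 + x)^2 >= x], so at [1 + x] the bound is at most
     [1 - 4 / 2 < 0]. *)
  pose (x := 4 * d / eps ^ 2).
  assert (He2 : 0 < eps ^ 2) by nra.
  assert (Hx : 0 < x) by (apply Rdiv_lt_0_compat; lra).
  pose proof (value_le d (- eps ^ 2) p_infty f f1 _ (1 + x) d_pos f_rad ltac:(lra) I) as B.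
  assert (B' : f (1 + x) <= f 0 + - eps ^ 2 / d * (1 + x) ^ 2 / 2).
  { apply B. intros s Hs. rewrite emden_rhs_unclamped by (try lra; specialize (Hge s ltac:(lra)); lra).
    specialize (Hge s ltac:(lra)). nra. }
  assert (E : eps ^ 2 / d * x = 4) by (unfold x; field; split; lra).
  assert (0 < eps ^ 2 / d) by (apply Rdiv_lt_0_compat; lra).
  assert (eps ^ 2 / d * x <= eps ^ 2 / d * (1 + x) ^ 2) by (apply Rmult_le_compat_l; nra).
  replace (- eps ^ 2 / d * (1 + x) ^ 2 / 2) with (- (eps ^ 2 / d * (1 + x) ^ 2 / 2)) in B' by (field; lra).
  specialize (Hf (1 + x) ltac:(lra)). rewrite f_0 in B'. lra.
Qed.

Lemma emden_lim_infty : (forall r, 0 < r -> 0 <= f r) -> is_lim f p_infty 0.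
Proof.
  intros Hf. apply is_lim_spec. intros eps.
  destruct (emden_small eps (cond_pos eps) Hf) as [r [Hr Hlt]]. exists r. intros x Hx.
  rewrite Rminus_0_r, Rabs_pos_eq by (apply Hf; lra).
  pose proof (emden_antitone r x ltac:(lra)). lra.
Qed.

Lemma Rpower_small_infty (e eps : R) : e < 0 -> 0 < eps -> exists r, 2 <= r /\ Rpower r e < eps.
Proof.
  intros He Heps.
  destruct (proj1 (lim0_spec _ _) (Rpower_lim0 (- e) ltac:(lra)) eps Heps) as [delta [Hd H]].
  pose proof (Rmin_l delta 1). pose proof (Rmin_r delta 1).
  assert (Hm : 0 < Rmin delta 1) by (apply Rmin_glb_lt; lra).
  pose (x := Rmin delta 1 / 2). assert (Hx : 0 < x <= / 2) by (unfold x; lra).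
  specialize (H x ltac:(unfold x; lra)). exists (/ x). split.
  - rewrite <- (Rinv_inv 2). apply Rinv_le_contravar; lra.
  - apply Rabs_def2 in H. unfold Rpower in *. rewrite ln_Rinv by lra.
    replace (e * - ln x) with (- e * ln x) by ring. lra.
Qed.

Lemma emden_crosses_subcritical : d < 6 -> exists r, 0 < r /\ f r < 0.
Proof.
  intros Hd. apply NNPP. intros Hn.
  assert (Hge : forall r, 0 < r -> 0 <= f r).
  { intros r Hr. apply Rnot_lt_le. intros Hlt. apply Hn. exists r; auto. }
  assert (Hpos : forall r, 0 < r -> 0 < f r).
  { intros r Hr. pose proof (Hge (r + 1) ltac:(lra)). pose proof (emden_decreasing r (r + 1) ltac:(lra)). lra. }
  assert (Hrhs : forall r, 0 < r -> - clamp (f r) ^ 2 = - f r ^ 2)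
    by (intros r Hr; apply emden_rhs_unclamped; [|specialize (Hge r Hr)]; lra).
  pose (P' := fun x => Rpower x (d - 1) * f x ^ 3 * ((6 - d) / 6)).
  assert (DP : forall x, 0 < x -> is_derive (pohozaev d f f1) x (P' x)).
  { intros x Hx. apply (pohozaev_derive d p_infty f f1 _ x f_rad Hx I (Hrhs x Hx)). }
  assert (HP' : forall x, 0 < x -> 0 < P' x).
  { intros x Hx. pose proof (pow_lt (f x) 3 (Hpos x Hx)).
    unfold P'. apply Rmult_lt_0_compat; [apply Rmult_lt_0_compat; [apply exp_pos|assumption]|lra]. }
  assert (P_ge : forall a b, 0 < a <= b -> pohozaev d f f1 a <= pohozaev d f f1 b).
  { intros a b Hab. apply Ropp_le_cancel.
    apply (antitone (fun x => - pohozaev d f f1 x) (fun x => - P' x)); [lra| |].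
    - intros x Hx. apply (is_derive_opp (pohozaev d f f1)), DP. lra.
    - intros x Hx. specialize (HP' x ltac:(lra)). lra. }
  (* Comparison with the limit at 0 yields only a weak inequality; strict positivity is gained
     between 1/2 and 1. *)
  assert (P_half : 0 <= pohozaev d f f1 (1 / 2)).
  { apply Ropp_le_cancel. rewrite Ropp_0.
    apply (antitone_lim0 (fun x => - pohozaev d f f1 x) (fun x => - P' x) (1 / 2)); [lra| | |].
    - intros x Hx. apply (is_derive_opp (pohozaev d f f1)), DP. lra.
    - intros x Hx. specialize (HP' x ltac:(lra)). lra.
    - eapply lim0_eq; [| |exact (lim0_scal (-1) _ _ (pohozaev_lim0 d p_infty f f1 _ d_pos f_rad))];
        intros; cbv beta; ring. }
  assert (P_1 : 0 < pohozaev d f f1 1).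
  { destruct (MVT_cor2 (pohozaev d f f1) P' (1 / 2) 1) as [c [E Hc]]; [lra| |].
    - intros c Hc. apply is_derive_Reals, DP. lra.
    - specialize (HP' c ltac:(lra)). nra. }
  (* Since [f] decreases, [f1 x <= - f x ^ 2 / d * x], that is [(1 / f)' >= x / d]. From 1 onwards
     this gives [1 / f >= (r^2 - 1) / (2 d)], which is at least [r^2 / (4 d)] once [r >= 2]. *)
  assert (Hdec : forall r, 2 <= r -> f r <= 4 * d / r ^ 2).
  { intros r Hr.
    assert (B : r ^ 2 / (2 * d) - / f r <= 1 ^ 2 / (2 * d) - / f 1).
    { apply (antitone (fun x => x ^ 2 / (2 * d) - / f x) (fun x => x / d + f1 x / f x ^ 2)); [lra| |].
      - intros x Hx. pose proof (rad_d f_rad x ltac:(lra) I) as D.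
        specialize (Hpos x ltac:(lra)).
        auto_derive.
        + split; [exists (f1 x); exact D|split; [lra|exact I]].
        + change (fun x : R => f x) with f. rewrite (is_derive_unique _ _ _ D). field. lra.
      - intros x Hx. specialize (Hpos x ltac:(lra)).
        assert (f1 x <= - f x ^ 2 / d * x).
        { apply (derivative_le d _ p_infty f f1 _ x d_pos f_rad); [lra|exact I|].
          intros s Hs. rewrite Hrhs by lra. pose proof (emden_antitone s x ltac:(lra)). nra. }
        assert (Hf2 : 0 < f x ^ 2) by nra.
        apply Rmult_le_reg_l with (f x ^ 2); [exact Hf2|].
        replace (f x ^ 2 * (x / d + f1 x / f x ^ 2)) with (f1 x - - f x ^ 2 / d * x) by (field; lra).
        lra. }
    pose proof (Hpos r ltac:(lra)) as Hr0. pose proof (Hpos 1 ltac:(lra)) as H10.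
    assert (0 < / f 1) by (apply Rinv_0_lt_compat, H10).
    assert (E : r ^ 2 / (4 * d) <= / f r).
    { assert (0 < / (2 * d)) by (apply Rinv_0_lt_compat; lra).
      assert (r ^ 2 / (4 * d) <= r ^ 2 / (2 * d) - 1 ^ 2 / (2 * d)); [|lra].
      replace (r ^ 2 / (4 * d)) with (r ^ 2 / 2 * / (2 * d)) by (field; lra).
      replace (r ^ 2 / (2 * d) - 1 ^ 2 / (2 * d)) with ((r ^ 2 - 1) * / (2 * d)) by (field; lra).
      apply Rmult_le_compat_r; nra. }
    rewrite <- (Rinv_inv (f r)).
    replace (4 * d / r ^ 2) with (/ (r ^ 2 / (4 * d))) by (field; split; lra).
    apply Rinv_le_contravar; [|exact E]. apply Rdiv_lt_0_compat; nra. }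
  pose (D := Rpower 2 d).
  assert (HD : 0 < D) by apply exp_pos.
  (* [K] collects the three terms of the Pohozaev function after inserting [- f1 r * r <= D * f r]
     and [f r * r^2 <= 4 d]; the later factor [16 d^2] bounds the remaining [r^4 f^2]. *)
  pose (K := D ^ 2 / 2 + Rabs (d - 2) / 2 * D + 4 * d / 3).
  assert (HA : 0 <= Rabs (d - 2)) by apply Rabs_pos.
  assert (HK : 0 < K) by (unfold K; nra).
  assert (Hup : forall r, 2 <= r -> pohozaev d f f1 r <= 16 * d ^ 2 * K * Rpower r (d - 6)).
  { intros r Hr.
    pose proof (Hpos r ltac:(lra)) as Hf. pose proof (emden_derive_neg r ltac:(lra)) as Hf1.
    pose proof (Hdec r Hr) as Hde.
    pose proof (derivative_doubling d f f1 _ r d_pos f_rad ltac:(lra)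
      (fun s _ => emden_rhs_nonpos s) Hge) as Hdb. fold D in Hdb.
    assert (Hr2 : 0 < r ^ 2) by nra.
    assert (Hfr : f r * r ^ 2 <= 4 * d).
    { apply Rmult_le_compat_r with (r := r ^ 2) in Hde; [|lra].
      replace (4 * d / r ^ 2 * r ^ 2) with (4 * d) in Hde by (field; lra). exact Hde. }
    assert (EW : Rpower r (d - 1) = r ^ 5 * Rpower r (d - 6)).
    { rewrite <- Rpower_pow by lra. rewrite <- Rpower_plus. f_equal. simpl. ring. }
    unfold pohozaev. rewrite EW.
    assert (HW : 0 < Rpower r (d - 6)) by apply exp_pos.
    replace (r ^ 5 * Rpower r (d - 6) * (r * (f1 r ^ 2 / 2 + f r ^ 3 / 3) + (d - 2) / 2 * f r * f1 r))
      with (Rpower r (d - 6) * (r ^ 4 * ((- f1 r * r) ^ 2 / 2 + (2 - d) / 2 * f r * (- f1 r * r)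
        + f r ^ 2 * (f r * r ^ 2) / 3))) by field.
    rewrite Rmult_comm. apply Rmult_le_compat_r; [lra|].
    set (q := - f1 r * r) in *. assert (Hq : 0 <= q) by (unfold q; nra).
    apply Rle_trans with (r ^ 4 * (f r ^ 2 * K)).
    - apply Rmult_le_compat_l; [nra|].
      assert (q ^ 2 <= (D * f r) ^ 2) by (apply pow_incr; lra).
      assert ((2 - d) / 2 * f r * q <= Rabs (d - 2) / 2 * f r * (D * f r)).
      { apply Rle_trans with (Rabs (d - 2) / 2 * f r * q).
        - pose proof (Rle_abs (- (d - 2))). rewrite Rabs_Ropp in H0.
          apply Rmult_le_compat_r; [exact Hq|]. apply Rmult_le_compat_r; lra.
        - apply Rmult_le_compat_l; [|exact Hdb]. apply Rmult_le_pos; lra. }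
      assert (f r ^ 2 * (f r * r ^ 2) <= f r ^ 2 * (4 * d)) by (apply Rmult_le_compat_l; nra).
      unfold K. nra.
    - replace (r ^ 4 * (f r ^ 2 * K)) with ((f r * r ^ 2) ^ 2 * K) by ring.
      apply Rmult_le_compat_r; [lra|].
      replace (16 * d ^ 2) with ((4 * d) ^ 2) by ring. apply pow_incr. split; [nra|exact Hfr]. }
  assert (HC : 0 < 16 * d ^ 2 * K) by (apply Rmult_lt_0_compat; nra).
  destruct (Rpower_small_infty (d - 6) (pohozaev d f f1 1 / (16 * d ^ 2 * K))) as [r [Hr Hlt]];
    [lra|apply Rdiv_lt_0_compat; assumption|].
  specialize (Hup r Hr). pose proof (P_ge 1 r ltac:(lra)).
  apply Rmult_lt_compat_l with (r := 16 * d ^ 2 * K) in Hlt; [|exact HC].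
  replace (16 * d ^ 2 * K * (pohozaev d f f1 1 / (16 * d ^ 2 * K))) with (pohozaev d f f1 1) in Hlt
    by (field; lra).
  lra.
Qed.

End LaneEmden.

(** * The initial value 1 in the two ranges of [d] *)

Lemma ground_state_supercritical (d : R) : 6 <= d -> setG d 1.
Proof.
  intros Hd. destruct (clamped_exists d ltac:(lra)) as [f [f1 [f2 [H0 [H1 [HD HE]]]]]].
  assert (HR : radial d p_infty f f1 (fun r => - clamp (f r) ^ 2)).
  { apply C2_on_radial with f2; [lra|exact I|apply C2_on_of_derive, HD|exact H1|].
    intros r Hr _; apply HE, Hr. }
  assert (Hpos : forall r, 0 < r -> 0 < f r)
    by (intros r Hr; apply (emden_pos_supercritical d f f1); auto; lra).
  split; [lra|]. exists f, (fun r => 1 - f r). split; [|split].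
  - split; [|intros T' u' V' _ _; destruct T'; exact I].
    apply (diagonal_solution d p_infty f f1 f2); auto; [exact I|].
    intros r Hr _. rewrite HE by exact Hr. apply (emden_rhs_unclamped d f f1); auto; [lra|].
    specialize (Hpos r Hr); lra.
  - intros r [Hr|<-]; [left; auto|lra].
  - apply (emden_lim_infty d f f1); auto; [lra|]. intros r Hr; left; auto.
Qed.

Lemma crossing_subcritical (d : R) : 0 < d -> d < 6 -> setN d 1.
Proof.
  intros Hd Hd6. destruct (clamped_exists d Hd) as [f [f1 [f2 [H0 [H1 [HD HE]]]]]].
  assert (HR : radial d p_infty f f1 (fun r => - clamp (f r) ^ 2)).
  { apply C2_on_radial with f2; [lra|exact I|apply C2_on_of_derive, HD|exact H1|].
    intros r Hr _; apply HE, Hr. }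
  destruct (emden_crosses_subcritical d f f1 Hd H0 HR Hd6) as [r1 [Hr1 Hneg]].
  pose proof (Rmax_l (f r1) (-1)) as M1. pose proof (Rmax_r (f r1) (-1)) as M2.
  assert (M3 : Rmax (f r1) (-1) < 0) by (apply Rmax_lub_lt; lra).
  (* A negative level not below -1: the truncation is inactive up to the point [z] where [f] reaches
     [c]. The witness [r0], at level [c / 2], comes strictly before [z], inside the interval where
     the solution is known to be [f]. *)
  set (c := Rmax (f r1) (-1)) in *.
  destruct (radial_ivt d c r1 p_infty f f1 _ HR ltac:(lra) Hr1 I M1) as [z [Hz Ez]].
  destruct (radial_ivt d (c / 2) z p_infty f f1 _ HR ltac:(lra) ltac:(lra) I ltac:(lra))
    as [r0 [Hr0 E0]].
  assert (Hlt : r0 < z) by (destruct (proj2 Hr0) as [H|H]; [exact H|subst; lra]).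
  assert (Hsol : is_solution d 1 (Finite z) f (fun r => 1 - f r)).
  { apply (diagonal_solution d _ f f1 f2); auto; [simpl; lra|].
    intros r Hr HrT. simpl in HrT. rewrite HE by exact Hr. apply (emden_rhs_unclamped d f f1); auto.
    pose proof (emden_antitone d f f1 Hd H0 HR r z ltac:(lra)). lra. }
  destruct (maximal_exists d 1 _ _ _ Hd Hsol) as [T [u [V [HT Hmax]]]].
  assert (Hagree : forall r, 0 < r -> Rbar_lt (Finite r) (Finite z) -> u r = f r).
  { intros r Hr HrT. apply (is_solution_unique d 1 T (Finite z) u V f (fun r => 1 - f r) Hd HT
      (proj1 Hmax) Hsol). split; [lra|exact HrT]. }
  split; [lra|]. exists T, u, V. split; [exact Hmax|]. exists r0.
  split; [lra|split; [|split]].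
  - apply Rbar_lt_le_trans with (Finite z); [exact Hlt|exact HT].
  - rewrite Hagree; [lra|lra|exact Hlt].
  (* [Derive u r] needs agreement of [u] with [f] around [r], which holds because [r <= r0 < z]. *)
  - intros r Hr. replace (Derive u r) with (f1 r).
    + apply (emden_derive_neg d f f1); auto; lra.
    + symmetry. apply is_derive_unique. apply (is_derive_ext_loc f); [|apply HD; lra].
      assert (Hm : 0 < Rmin r (z - r)) by (apply Rmin_glb_lt; lra).
      exists (mkposreal _ Hm). intros y Hy. change (Rabs (y - r) < Rmin r (z - r)) in Hy.
      pose proof (Rmin_l r (z - r)). pose proof (Rmin_r r (z - r)). apply Rabs_def2 in Hy.
      symmetry. apply Hagree; simpl; lra.
Qed.

(** * Initial values of ground states *)

Section GlobalNonnegative.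

Variables (d : R) (u u1 V V1 : R -> R).
Hypotheses (d_pos : 0 < d) (u_0 : 0 < u 0) (V_0 : V 0 = 0)
  (u_rad : radial d p_infty u u1 (fun r => (V r - 1) * u r))
  (V_rad : radial d p_infty V V1 (fun r => u r ^ 2))
  (u_ge0 : forall r, 0 < r -> 0 <= u r).

Let z (r : R) : R := u r + V r - 1.

(* Since [z'' + (d-1)/r z' = u z] with [u >= 0], [z^2] is nondecreasing. *)
Lemma diagonal_gap_radial : radial d p_infty z (fun r => u1 r + V1 r) (fun r => u r * z r).
Proof.
  pose proof (radial_comb d 1 1 _ _ _ _ _ _ _
    (radial_comb d 1 1 _ _ _ _ _ _ _ u_rad V_rad) (radial_const d (-1) p_infty)) as [H1 H2 H3 H4 H5].
  split.
  - intros r Hr HT. evar_last.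
    + apply (is_derive_ext (fun r => 1 * (1 * u r + 1 * V r) + 1 * -1)); [|exact (H1 r Hr HT)].
      intros t. unfold z. change (1 * (1 * u t + 1 * V t) + 1 * -1 = u t + V t - 1 :> R). ring.
    + cbv beta. ring.
  - intros r Hr HT. evar_last.
    + apply (is_derive_ext (fun r => 1 * (1 * u1 r + 1 * V1 r) + 1 * 0)); [|exact (H2 r Hr HT)].
      intros t. change (1 * (1 * u1 t + 1 * V1 t) + 1 * 0 = u1 t + V1 t :> R). ring.
    + unfold z. cbv beta. ring.
  - eapply lim0_eq; [| |exact H3]; intros; unfold z; cbv beta; ring.
  - eapply lim0_eq; [| |exact H4]; intros; cbv beta; ring.
  - eapply lim0_eq; [| |exact H5]; intros; cbv beta; ring.
Qed.

(** Two monotonicity steps: [r^(d-1) z z'] has derivative [r^(d-1) (z'^2 + u z^2) >= 0] and starts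
    from 0, so [(z^2)' = 2 z z' >= 0]; and [z 0 = u 0 - 1]. *)
Lemma diagonal_gap_sqr (r : R) : 0 < r -> (u 0 - 1) ^ 2 <= z r ^ 2.
Proof.
  intros Hr. pose proof diagonal_gap_radial as Z.
  assert (Hzz : forall x, 0 < x -> 0 <= z x * (u1 x + V1 x)).
  { intros x Hx. assert (Hp : 0 < Rpower x (d - 1)) by apply exp_pos.
    assert (- (z x * (Rpower x (d - 1) * (u1 x + V1 x))) <= 0); [|nra].
    apply (antitone_lim0 (fun x => - (z x * (Rpower x (d - 1) * (u1 x + V1 x))))
      (fun x => - (Rpower x (d - 1) * ((u1 x + V1 x) ^ 2 + u x * z x ^ 2))) x 0 Hx).
    - intros y Hy. evar_last.
      + apply @is_derive_opp. apply (is_derive_mult z (fun y => Rpower y (d - 1) * (u1 y + V1 y))).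
        * apply (rad_d Z); [lra|exact I].
        * apply (flux_derive d p_infty _ _ _ y Z); [lra|exact I].
        * exact Rmult_comm.
      + unfold plus, mult, opp; simpl. ring.
    - intros y Hy. assert (0 < Rpower y (d - 1)) by apply exp_pos.
      pose proof (u_ge0 y ltac:(lra)). pose proof (pow2_ge_0 (z y)). pose proof (pow2_ge_0 (u1 y + V1 y)).
      assert (0 <= u y * z y ^ 2) by (apply Rmult_le_pos; assumption).
      assert (0 <= Rpower y (d - 1) * ((u1 y + V1 y) ^ 2 + u y * z y ^ 2)) by (apply Rmult_le_pos; lra).
      lra.
    - eapply lim0_eq; [| |exact (lim0_scal (-1) _ _ (lim0_mult _ _ _ _ (rad_l Z) (rad_lflux Z)))];
        intros; cbv beta; ring. }
  enough (- z r ^ 2 <= - (u 0 - 1) ^ 2) by lra.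
  apply (antitone_lim0 (fun x => - z x ^ 2) (fun x => - (2 * (z x * (u1 x + V1 x)))) r); [exact Hr| | |].
  - intros x Hx. pose proof (rad_d Z x ltac:(lra) I) as D. evar_last.
    + apply @is_derive_opp. apply (is_derive_pow z 2 x _ D).
    + unfold opp; simpl. ring.
  - intros x Hx. specialize (Hzz x ltac:(lra)). lra.
  - eapply lim0_eq; [| |exact (lim0_scal (-1) _ _ (lim0_mult _ _ _ _ (rad_l Z) (rad_l Z)))].
    + intros; cbv beta; ring.
    + unfold z. rewrite V_0. ring.
Qed.

(** The bound on [z^2] forbids zeros of [z], so by the intermediate value theorem [z] keeps the sign
    of [u 0 - 1]. *)
Lemma diagonal_gap_above (r : R) : 1 < u 0 -> 0 < r -> u 0 - 1 <= z r.
Proof.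
  intros H Hr. pose proof (diagonal_gap_sqr r Hr) as S.
  destruct (Rle_or_lt (z r) 0) as [Hle|Hlt]; [|nra].
  destruct (radial_ivt d 0 r p_infty z _ _ diagonal_gap_radial) as [x [Hx E]]; auto;
    [unfold z; rewrite V_0; lra|exact I|].
  pose proof (diagonal_gap_sqr x ltac:(lra)) as S'. rewrite E in S'. nra.
Qed.

Lemma diagonal_gap_below (r : R) : u 0 < 1 -> 0 < r -> z r <= - (1 - u 0).
Proof.
  intros H Hr. pose proof (diagonal_gap_sqr r Hr) as S.
  destruct (Rle_or_lt 0 (z r)) as [Hle|Hlt]; [|nra].
  destruct (radial_ivt d 0 r p_infty _ _ _ (radial_opp _ _ _ _ _ diagonal_gap_radial)) as [x [Hx E]];
    auto; [unfold z; rewrite V_0; lra|exact I|lra|].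
  pose proof (diagonal_gap_sqr x ltac:(lra)) as S'. replace (z x) with 0 in S' by lra. nra.
Qed.

(* If [u 0 < 1] then [V - 1 <= - c < 0] throughout, so [- u'] is at least of order [r u],
   against the doubling bound [- u' = O(u / r)]. *)
Lemma initial_value_ge_1 : 1 <= u 0.
Proof.
  apply Rnot_lt_le. intros H. pose (c := 1 - u 0). assert (Hc : 0 < c) by (unfold c; lra).
  assert (HV : forall r, 0 < r -> V r - 1 <= - c).
  { intros r Hr. pose proof (diagonal_gap_below r H Hr) as B. pose proof (u_ge0 r Hr).
    unfold z, c in *. lra. }
  assert (Hh : forall r, 0 < r -> (V r - 1) * u r <= - c * u r).
  { intros r Hr. apply Rmult_le_compat_r; [apply u_ge0, Hr|apply HV, Hr]. }
  assert (Hh0 : forall r, 0 < r -> (V r - 1) * u r <= 0).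
  { intros r Hr. specialize (Hh r Hr). specialize (u_ge0 r Hr). nra. }
  assert (Hu1 : forall r, 0 < r -> u1 r < 0).
  { intros r Hr. apply (derivative_neg d p_infty u u1 _ ((V 0 - 1) * u 0) r d_pos u_rad Hr I).
    - intros s Hs; apply Hh0; lra.
    - apply lim0_mult; [|apply (rad_l u_rad)]. apply lim0_minus; [apply (rad_l V_rad)|apply lim0_const].
    - rewrite V_0. nra. }
  pose (D := Rpower 2 d). assert (HD : 0 < D) by apply exp_pos.
  assert (HD' : 0 < D * d / c) by (apply Rdiv_lt_0_compat; nra).
  (* The two bounds on [- u1 r] force [c / d * r^2 <= D], which fails for this [r] since
     [r^2 >= r > D * d / c]. *)
  pose (r := 1 + D * d / c). assert (Hr : 0 < r) by (unfold r; lra).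
  pose proof (derivative_doubling d u u1 _ r d_pos u_rad Hr Hh0 u_ge0) as Hdb. fold D in Hdb.
  assert (Hf : u1 r <= - c * u r / d * r).
  { apply (derivative_le d _ p_infty u u1 _ r d_pos u_rad Hr I). intros s Hs.
    assert (u r <= u s).
    { apply (radial_antitone d s r p_infty u u1 _ u_rad); [lra|exact I|].
      intros x Hx; left; apply Hu1; lra. }
    specialize (Hh s ltac:(lra)). nra. }
  pose proof (Hu1 r Hr) as Hneg.
  assert (Hur : 0 < u r) by nra.
  assert (c / d * (u r * r ^ 2) <= D * u r).
  { replace (c / d * (u r * r ^ 2)) with (- (- c * u r / d * r) * r) by (field; lra). nra. }
  assert (B : c / d * r ^ 2 <= D).
  { apply Rmult_le_reg_l with (u r); [exact Hur|]. lra. }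
  assert (E : c / d * (D * d / c) = D) by (field; lra).
  assert (0 < c / d) by (apply Rdiv_lt_0_compat; lra).
  assert (D * d / c < r ^ 2) by (unfold r; nra). nra.
Qed.

(** The flux of [V] is nondecreasing, so its positive value at one point bounds it from below
    further out: [r^(d-1) V1] cannot tend to 0. *)
Lemma potential_flux_pos (r : R) : 0 < r -> 0 < Rpower r (d - 1) * V1 r.
Proof.
  intros Hr. pose proof (derivative_neg d p_infty _ _ _ (- u 0 ^ 2) r d_pos
    (radial_opp _ _ _ _ _ V_rad) Hr I) as N. cbv beta in N.
  assert (0 < V1 r); [|apply Rmult_lt_0_compat; [apply exp_pos|assumption]].
  enough (- V1 r < 0) by lra. apply N.
  - intros s Hs. pose proof (pow2_ge_0 (u s)). lra.
  - eapply lim0_eq; [| |exact (lim0_scal (-1) _ _ (lim0_mult _ _ _ _ (rad_l u_rad) (rad_l u_rad)))];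
      intros; cbv beta; ring.
  - nra.
Qed.

(** The energy [u'^2 / 2 + V'^2 / 4 - (V - 1) u^2 / 2], conserved for [d = 1], completed by the
    weight and the dilation terms. On the diagonal [V = 1 - u] it is 3/2 times [pohozaev]. *)
Definition system_pohozaev (r : R) : R :=
  Rpower r (d - 1) * (r * (u1 r ^ 2 / 2 + V1 r ^ 2 / 4 - (V r - 1) * u r ^ 2 / 2)
    + (d - 2) / 2 * u r * u1 r + (d - 2) / 4 * (V r - 1) * V1 r).

Lemma system_pohozaev_derive (r : R) : 0 < r ->
  is_derive system_pohozaev r (Rpower r (d - 1) * ((1 - V r) * u r ^ 2) * ((6 - d) / 4)).
Proof.
  intros Hr.
  pose proof (rad_d u_rad r Hr I) as D. pose proof (rad_d1 u_rad r Hr I) as D1. cbv beta in D1.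
  pose proof (rad_d V_rad r Hr I) as G. pose proof (rad_d1 V_rad r Hr I) as G1. cbv beta in G1.
  pose (W := fun x => Rpower x (d - 1)).
  assert (DW : is_derive W r ((d - 1) / r * W r)) by exact (is_derive_Rpower r (d - 1) Hr).
  unfold system_pohozaev.
  change (is_derive (fun x => W x * (x * (u1 x ^ 2 / 2 + V1 x ^ 2 / 4 - (V x - 1) * u x ^ 2 / 2)
    + (d - 2) / 2 * u x * u1 x + (d - 2) / 4 * (V x - 1) * V1 x)) r
    (W r * ((1 - V r) * u r ^ 2) * ((6 - d) / 4))).
  clearbody W.
  auto_derive.
  - assert (ex_derive W r /\ ex_derive u r /\ ex_derive u1 r /\ ex_derive V r /\ ex_derive V1 r).
    { split; [eexists; exact DW|]. split; [eexists; exact D|]. split; [eexists; exact D1|].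
      split; eexists; [exact G|exact G1]. }
    tauto.
  - change (fun x : R => W x) with W. change (fun x : R => u x) with u.
    change (fun x : R => u1 x) with u1. change (fun x : R => V x) with V.
    change (fun x : R => V1 x) with V1.
    rewrite (is_derive_unique _ _ _ D), (is_derive_unique _ _ _ D1), (is_derive_unique _ _ _ DW),
      (is_derive_unique _ _ _ G), (is_derive_unique _ _ _ G1).
    field. lra.
Qed.

Lemma system_pohozaev_lim0 : lim0 system_pohozaev 0.
Proof.
  pose proof (rad_l u_rad) as L. pose proof (rad_l1 u_rad) as L1. pose proof (rad_lflux u_rad) as LF.
  pose proof (rad_l V_rad) as G. pose proof (rad_l1 V_rad) as G1. pose proof (rad_lflux V_rad) as GF.
  pose proof (Rpower_lim0 d d_pos) as LP.
  pose proof (lim0_minus _ _ _ _ G (lim0_const 1)) as GV.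
  pose proof (lim0_mult _ _ _ _ lim0_id (lim0_mult _ _ _ _ LF (lim0_scal (/ 2) _ _ L1))) as T1.
  pose proof (lim0_mult _ _ _ _ lim0_id (lim0_mult _ _ _ _ GF (lim0_scal (/ 4) _ _ G1))) as T2.
  pose proof (lim0_mult _ _ _ _ LP (lim0_scal (/ 2) _ _
    (lim0_mult _ _ _ _ GV (lim0_mult _ _ _ _ L L)))) as T3.
  pose proof (lim0_mult _ _ _ _ LF (lim0_scal ((d - 2) / 2) _ _ L)) as T4.
  pose proof (lim0_mult _ _ _ _ GF (lim0_scal ((d - 2) / 4) _ _ GV)) as T5.
  eapply lim0_eq; [| |exact (lim0_plus _ _ _ _ (lim0_minus _ _ _ _ (lim0_plus _ _ _ _ T1 T2) T3)
    (lim0_plus _ _ _ _ T4 T5))].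
  - intros x Hx. cbv beta. unfold system_pohozaev. rewrite (Rpower_split x d Hx). field.
  - ring.
Qed.

Lemma system_pohozaev_critical (r : R) : d = 6 -> 0 < r -> system_pohozaev r = 0.
Proof.
  intros Hd Hr.
  assert (Hder : forall x, 0 < x -> is_derive system_pohozaev x 0).
  { intros x Hx. evar_last; [apply system_pohozaev_derive, Hx|]. rewrite Hd. field. }
  apply Rle_antisym.
  - apply (antitone_lim0 _ (fun _ => 0) r 0 Hr); [|intros; lra|exact system_pohozaev_lim0].
    intros x Hx; apply Hder; lra.
  - apply Ropp_le_cancel. rewrite Ropp_0.
    apply (antitone_lim0 (fun x => - system_pohozaev x) (fun _ => 0) r 0 Hr); [|intros; lra|].
    + intros x Hx. evar_last; [apply @is_derive_opp, Hder; lra|]. unfold opp; simpl; ring.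
    + eapply lim0_eq; [| |exact (lim0_scal (-1) _ _ system_pohozaev_lim0)]; intros; cbv beta; ring.
Qed.

(** * Decay of a ground state where [V - 1] is bounded below *)

Hypothesis (u_lim : is_lim u p_infty 0).

Lemma ground_eventually_small (eps : R) : 0 < eps -> exists M, forall r, M < r -> u r < eps.
Proof.
  intros He. pose proof u_lim as L. apply is_lim_spec in L.
  destruct (L (mkposreal eps He)) as [M HM]. exists M. intros r Hr. specialize (HM r Hr).
  simpl in HM. rewrite Rminus_0_r in HM.
  apply Rabs_def2 in HM. lra.
Qed.

Lemma ground_not_bounded_below (r0 c : R) : 0 < c -> ~ (forall r, r0 <= r -> c <= u r).
Proof.
  intros Hc H. destruct (ground_eventually_small c Hc) as [M HM].
  pose proof (Rmax_l r0 (M + 1)). pose proof (Rmax_r r0 (M + 1)).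
  specialize (H (Rmax r0 (M + 1)) ltac:(lra)). specialize (HM (Rmax r0 (M + 1)) ltac:(lra)). lra.
Qed.

Section Decay.

Variables (c R0 : R).
Hypotheses (d_ge1 : 1 <= d) (c_pos : 0 < c) (R0_pos : 0 < R0) (V_ge : forall r, R0 <= r -> c <= V r - 1).

(** Where [V >= 1] the flux of [u] is nondecreasing; once positive it stays positive, and [u] would
    increase instead of tending to 0. *)
Lemma ground_derive_nonpos_far (r : R) : R0 <= r -> u1 r <= 0.
Proof.
  intros Hr. apply Rnot_lt_le. intros Hpos.
  assert (Hall : forall x, r <= x -> 0 < u1 x).
  { intros x Hx. pose proof (flux_antitone d p_infty _ _ _ r x (radial_opp _ _ _ _ _ u_rad)
      ltac:(lra) I) as F. cbv beta in F.
    specialize (F ltac:(intros s Hs; specialize (V_ge s ltac:(lra)); specialize (u_ge0 s ltac:(lra)); nra)).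
    assert (0 < Rpower r (d - 1)) by apply exp_pos. assert (0 < Rpower x (d - 1)) by apply exp_pos. nra. }
  assert (Hmono : forall a b, r <= a < b -> u a < u b).
  { intros a b Hab. destruct (MVT_cor2 u u1 a b) as [x [E Hx]]; [lra| |].
    - intros x Hx. apply is_derive_Reals, (rad_d u_rad); [lra|exact I].
    - specialize (Hall x ltac:(lra)). nra. }
  apply (ground_not_bounded_below (r + 1) (u (r + 1))).
  - pose proof (Hmono r (r + 1) ltac:(lra)). pose proof (u_ge0 r ltac:(lra)). lra.
  - intros x [Hx| <-]; [left; apply Hmono; lra|lra].
Qed.

(* [u'^2 - c u^2] is nonincreasing far out; were it negative somewhere, [u] could not
   tend to 0. *)
Lemma ground_derive_sqr_ge_far (r : R) : R0 <= r -> c * u r ^ 2 <= u1 r ^ 2.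
Proof.
  intros Hr. apply Rnot_lt_le. intros Hlt. pose (delta := c * u r ^ 2 - u1 r ^ 2).
  assert (Hd : 0 < delta) by (unfold delta; lra).
  assert (Hdec : forall x, r <= x -> delta <= c * u x ^ 2).
  { intros x Hx.
    enough (u1 x ^ 2 - c * u x ^ 2 <= u1 r ^ 2 - c * u r ^ 2)
      by (pose proof (pow2_ge_0 (u1 x)); unfold delta; lra).
    apply (antitone (fun x => u1 x ^ 2 - c * u x ^ 2)
      (fun x => 2 * (u x * u1 x * (V x - 1 - c)) - 2 * ((d - 1) / x * u1 x ^ 2))); [exact Hx| |].
    - intros y Hy. pose proof (rad_d u_rad y ltac:(lra) I) as D.
      pose proof (rad_d1 u_rad y ltac:(lra) I) as D1. cbv beta in D1.
      evar_last.
      + exact (is_derive_minus _ _ _ _ _ (is_derive_pow u1 2 y _ D1)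
          (is_derive_scal _ _ c _ (is_derive_pow u 2 y _ D))).
      + unfold minus, plus, opp; simpl. field. lra.
    - intros y Hy. pose proof (ground_derive_nonpos_far y ltac:(lra)). pose proof (u_ge0 y ltac:(lra)).
      pose proof (V_ge y ltac:(lra)). pose proof (pow2_ge_0 (u1 y)).
      assert (0 <= (d - 1) / y) by (apply Rcomplements.Rdiv_le_0_compat; lra).
      assert (0 <= (d - 1) / y * u1 y ^ 2) by (apply Rmult_le_pos; assumption).
      assert (0 <= u y * - u1 y) by (apply Rmult_le_pos; lra).
      assert (0 <= u y * - u1 y * (V y - 1 - c)) by (apply Rmult_le_pos; lra).
      lra. }
  (* With [e <= 1] and [e <= delta / c], [u x < e] would give [u x ^ 2 < delta / c], against [Hdec];
     this avoids a square root. *)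
  pose (e := Rmin 1 (delta / c)).
  assert (Hdc : 0 < delta / c) by (apply Rdiv_lt_0_compat; lra).
  assert (He : 0 < e) by (apply Rmin_glb_lt; lra).
  pose proof (Rmin_l 1 (delta / c)) as E1. pose proof (Rmin_r 1 (delta / c)) as E2. fold e in E1, E2.
  apply (ground_not_bounded_below r e He). intros x Hx. specialize (Hdec x Hx).
  pose proof (u_ge0 x ltac:(lra)). apply Rnot_lt_le. intros Hux.
  assert (u x ^ 2 < e) by nra.
  assert (c * (delta / c) = delta) by (field; lra). nra.
Qed.

(** From [u1 <= - sqrt c * u] follows [r u1 + 5 u <= 0] as soon as [sqrt c * r >= 5], which is the
    condition on [a]. The exponent 5 is more than enough for [r^6 u^2] and [r^4 u^2] to tend to
    0. *)
Lemma ground_pow5_antitone_far (a b : R) :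
  R0 <= a <= b -> 25 <= c * a ^ 2 -> u b * b ^ 5 <= u a * a ^ 5.
Proof.
  intros Hab Hca.
  apply (antitone (fun x => u x * x ^ 5) (fun x => x ^ 4 * (u1 x * x + 5 * u x))); [lra| |].
  - intros x Hx. pose proof (rad_d u_rad x ltac:(lra) I) as D.
    evar_last.
    + exact (is_derive_mult u (fun x => x ^ 5) x _ _ D
        (is_derive_pow (fun x => x) 5 x _ (is_derive_id x)) Rmult_comm).
    + unfold plus, mult, one; simpl. ring.
  - intros x Hx. pose proof (ground_derive_nonpos_far x ltac:(lra)). pose proof (u_ge0 x ltac:(lra)).
    pose proof (ground_derive_sqr_ge_far x ltac:(lra)) as Hu.
    assert (0 <= x ^ 4) by (apply pow_le; lra).
    enough (u1 x * x + 5 * u x <= 0) by nra.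
    apply Rnot_lt_le. intros Hlt.
    assert (25 <= c * x ^ 2) by (apply Rle_trans with (c * a ^ 2);
      [exact Hca|apply Rmult_le_compat_l; [lra|apply pow_incr; lra]]).
    assert (B1 : (- u1 x * x) ^ 2 < (5 * u x) ^ 2).
    { assert (0 <= - u1 x * x) by (apply Rmult_le_pos; lra). nra. }
    assert (B2 : x ^ 2 * (c * u x ^ 2) <= x ^ 2 * u1 x ^ 2)
      by (apply Rmult_le_compat_l; [apply pow2_ge_0|exact Hu]).
    assert (B3 : 25 * u x ^ 2 <= c * x ^ 2 * u x ^ 2)
      by (apply Rmult_le_compat_r; [apply pow2_ge_0|assumption]).
    nra.
Qed.

End Decay.

(** In the vanishing Pohozaev function, [(V - 1) r^5 V1] stays above a positive constant, the terms
    in [u^2] tend to 0, and the rest is a sum of squares. *)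
Lemma initial_value_le_1 : d = 6 -> u 0 <= 1.
Proof.
  intros Hd6. apply Rnot_lt_le. intros Hu0.
  (* [u + V - 1 >= u 0 - 1 = 2 c], and [u < c] far out, so [V - 1 >= c] there. *)
  pose (c := (u 0 - 1) / 2). assert (Hc : 0 < c) by (unfold c; lra).
  destruct (ground_eventually_small c Hc) as [M HM].
  pose (R0 := Rmax M 0 + 1). pose proof (Rmax_l M 0). pose proof (Rmax_r M 0).
  assert (HR0 : 0 < R0) by (unfold R0; lra).
  assert (HV : forall r, R0 <= r -> c <= V r - 1).
  { intros r Hr. specialize (HM r ltac:(unfold R0 in Hr; lra)).
    pose proof (diagonal_gap_above r Hu0 ltac:(lra)) as Z. unfold z, c in *. lra. }
  assert (H5c : 0 < 5 / c) by (apply Rdiv_lt_0_compat; lra).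
  pose (R1 := R0 + 5 + 5 / c).
  assert (HR1 : 25 <= c * R1 ^ 2).
  { assert (E : c * (5 / c) = 5) by (field; lra).
    assert (5 <= c * R1) by (unfold R1; nra). assert (5 <= R1) by (unfold R1; lra). nra. }
  pose (K := u R1 * R1 ^ 5). pose (k := Rpower R1 (d - 1) * V1 R1).
  assert (Hk : 0 < k) by (apply potential_flux_pos; unfold R1; lra).
  assert (HK : 0 <= K ^ 2) by apply pow2_ge_0.
  assert (Hq1 : 0 <= K ^ 2 / k) by (apply Rcomplements.Rdiv_le_0_compat; lra).
  assert (Hck : 0 < c * k) by (apply Rmult_lt_0_compat; assumption).
  assert (Hq2 : 0 <= 4 * K ^ 2 / (c * k)) by (apply Rcomplements.Rdiv_le_0_compat; lra).
  (* The two added terms serve [S1] and [S2]: [r^6 u^2 <= k] and [4 r^4 u^2 < c k], both from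
     [u r^5 <= K]. *)
  pose (r := R1 + K ^ 2 / k + 4 * K ^ 2 / (c * k)).
  assert (Hr5 : 5 < r) by (unfold r, R1; lra).
  assert (HrR1 : R1 <= r) by (unfold r; lra).
  assert (HrR0 : R0 <= r) by (unfold r, R1; lra).
  pose proof (ground_pow5_antitone_far c R0 ltac:(lra) Hc HR0 HV R1 r ltac:(unfold R1 in *; lra) HR1) as HuK.
  fold K in HuK. pose proof (u_ge0 r ltac:(lra)) as Hur.
  assert (HuK2 : (u r * r ^ 5) ^ 2 <= K ^ 2).
  { apply pow_incr. split; [apply Rmult_le_pos; [exact Hur|apply pow_le; lra]|exact HuK]. }
  pose proof (HV r HrR0) as Hb. set (b := V r - 1) in *.
  assert (Hflux : k <= r ^ 5 * V1 r).
  { pose proof (flux_antitone d p_infty _ _ _ R1 r (radial_opp _ _ _ _ _ V_rad)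
      ltac:(unfold R1 in *; lra) I) as F. cbv beta in F.
    specialize (F ltac:(intros s _; pose proof (pow2_ge_0 (u s)); lra)).
    assert (EW : Rpower r (d - 1) = r ^ 5).
    { rewrite <- Rpower_pow by lra. f_equal. rewrite Hd6. simpl. ring. }
    rewrite <- EW. unfold k. lra. }
  pose proof (system_pohozaev_critical r Hd6 ltac:(lra)) as P. unfold system_pohozaev in P.
  assert (Hp : 0 < Rpower r (d - 1)) by apply exp_pos.
  apply Rmult_integral in P. destruct P as [P|P]; [lra|].
  rewrite Hd6 in P. fold b in P.
  (* The mixed term [2 r^5 u u1] is absorbed by completing the square with [r^6 u1^2 / 2], at the
     cost of [2 r^4 u^2]. *)
  assert (Q : r ^ 5 * (r * (V1 r ^ 2 / 4)) + r ^ 4 * (r * u1 r + 2 * u r) ^ 2 / 2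
    = r ^ 6 * (b * u r ^ 2 / 2) + 2 * (r ^ 4 * u r ^ 2) - b * (r ^ 5 * V1 r)).
  { apply Rminus_diag_uniq. apply (f_equal (fun x => r ^ 5 * x)) in P. rewrite Rmult_0_r in P.
    rewrite <- P. field. }
  assert (Q1 : 0 <= r ^ 5 * (r * (V1 r ^ 2 / 4))).
  { apply Rmult_le_pos; [apply pow_le; lra|]. pose proof (pow2_ge_0 (V1 r)). nra. }
  assert (Q2 : 0 <= r ^ 4 * (r * u1 r + 2 * u r) ^ 2).
  { apply Rmult_le_pos; [apply pow_le; lra|apply pow2_ge_0]. }
  assert (Hr4 : r <= r ^ 4).
  { replace (r ^ 4) with (r * r ^ 3) by ring. rewrite <- (Rmult_1_r r) at 1.
    apply Rmult_le_compat_l; [lra|]. apply pow_R1_Rle. lra. }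
  assert (Hr6 : r <= r ^ 6).
  { replace (r ^ 6) with (r * r ^ 5) by ring. rewrite <- (Rmult_1_r r) at 1.
    apply Rmult_le_compat_l; [lra|]. apply pow_R1_Rle. lra. }
  assert (S1 : r ^ 6 * u r ^ 2 <= k).
  { apply Rmult_le_reg_r with (r ^ 4); [lra|].
    replace (r ^ 6 * u r ^ 2 * r ^ 4) with ((u r * r ^ 5) ^ 2) by ring.
    apply Rle_trans with (K ^ 2); [exact HuK2|].
    replace (K ^ 2) with (k * (K ^ 2 / k)) by (field; lra).
    apply Rmult_le_compat_l; [lra|]. unfold r at 1 in Hr4. unfold R1 in *. lra. }
  assert (S2 : 4 * (r ^ 4 * u r ^ 2) < c * k).
  { apply Rmult_lt_reg_r with (r ^ 6); [lra|].
    replace (4 * (r ^ 4 * u r ^ 2) * r ^ 6) with (4 * (u r * r ^ 5) ^ 2) by ring.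
    apply Rle_lt_trans with (4 * K ^ 2); [lra|].
    replace (4 * K ^ 2) with (c * k * (4 * K ^ 2 / (c * k))) by (field; lra).
    apply Rmult_lt_compat_l; [lra|]. unfold r at 1 in Hr6. unfold R1 in *. lra. }
  (* The left side of [Q] is nonnegative, while the right side is below
     [b k / 2 + c k / 2 - b k <= 0]. *)
  assert (B1 : b * (r ^ 6 * u r ^ 2) <= b * k) by (apply Rmult_le_compat_l; lra).
  assert (B2 : b * k <= b * (r ^ 5 * V1 r)) by (apply Rmult_le_compat_l; lra).
  assert (B3 : c * k <= b * k) by (apply Rmult_le_compat_r; lra).
  lra.
Qed.

End GlobalNonnegative.

(** * The critical dimension and its explicit ground state *)

Lemma ground_state_critical_unique (u0 : R) : setG 6 u0 -> u0 = 1.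
Proof.
  intros [Hu0 [u [V [[Hsol _] [Hge Hlim]]]]].
  apply is_solution_solves in Hsol as [_ [E [u1 [u2 [V1 [V2 H]]]]]].
  destruct (solves_radial 6 p_infty u u1 u2 V V1 V2 ltac:(lra) I H) as [HU HV].
  destruct H as [_ [_ [_ [_ [V0 _]]]]]. rewrite <- E in Hu0 |- *.
  assert (Hge' : forall r, 0 < r -> 0 <= u r) by (intros r Hr; apply Hge; lra).
  apply Rle_antisym.
  - apply (initial_value_le_1 6 u u1 V V1); auto; lra.
  - apply (initial_value_ge_1 6 u u1 V V1); auto; lra.
Qed.

Ltac nonzero_product :=
  simpl; repeat (apply conj || apply Rmult_integral_contrapositive_currified); try exact I; lra.

(** The case [d = 6] of the Aubin-Talenti functions [(1 + r^2 / (d (d - 2)))^(-(d - 2) / 2)], which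
    solve the Lane-Emden equation with the critical exponent [(d + 2) / (d - 2)]; here
    [d (d - 2) = 24] and the exponent is 2. *)
Lemma explicit_solution :
  is_solution 6 1 p_infty (fun r => / (1 + r ^ 2 / 24) ^ 2) (fun r => 1 - / (1 + r ^ 2 / 24) ^ 2).
Proof.
  assert (Hp : forall r : R, 0 < 1 + r ^ 2 / 24) by (intros r; pose proof (pow2_ge_0 r); lra).
  apply (diagonal_solution 6 p_infty _ (fun r => - (r / 6) * / (1 + r ^ 2 / 24) ^ 3)
    (fun r => - / 6 * / (1 + r ^ 2 / 24) ^ 3 + r ^ 2 / 24 * / (1 + r ^ 2 / 24) ^ 4)).
  - exact I.
  - field.
  - field.
  - intros r _. pose proof (Hp r) as Hr. split; [|split].
    + auto_derive; [nonzero_product|field; nonzero_product].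
    + auto_derive; [nonzero_product|field; nonzero_product].
    + apply @ex_derive_continuous. auto_derive. nonzero_product.
  - intros r Hr _. pose proof (Hp r). field. nonzero_product.
Qed.

Theorem theorem4p1 (d : R) (hd : 0 < d) :
  (6 <= d -> setG d 1) /\
  (d < 6 -> setN d 1) /\
  (d = 6 ->
   forall (u0 : R) (T : Rbar) (u V : R -> R),
     setG d u0 -> is_maximal_solution d u0 T u V ->
     u0 = 1 /\ T = p_infty /\
     forall r, 0 <= r -> u r = / (1 + r ^ 2 / 24) ^ 2).
Proof.
  split; [apply ground_state_supercritical|split; [apply crossing_subcritical, hd|]].
  intros -> u0 T u V HG [Hsol Hmax]. apply ground_state_critical_unique in HG as ->.
  assert (HT : Rbar_le T p_infty) by (destruct T; exact I).
  assert (E : T = p_infty).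
  (* By uniqueness the explicit global solution extends the given one, so maximality leaves no
     finite [T]. *)
  { apply Rbar_le_antisym; [exact HT|].
    apply (Hmax p_infty (fun r => / (1 + r ^ 2 / 24) ^ 2) (fun r => 1 - / (1 + r ^ 2 / 24) ^ 2)
      explicit_solution).
    exact (is_solution_unique 6 1 p_infty T _ _ u V ltac:(lra) HT explicit_solution Hsol). }
  subst T. split; [reflexivity|split; [reflexivity|]]. intros r Hr. symmetry.
  apply (is_solution_unique 6 1 p_infty p_infty _ _ u V ltac:(lra) HT explicit_solution Hsol).
  split; [exact Hr|exact I].
Qed.
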